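(* Let $\varsigma,\tau,\delta,\zeta\in\mathbb{T}$ with $|\operatorname{Im}_j(\tau)|<\operatorname{Re}(\tau)$ and $|\operatorname{Im}_j(\varsigma)|<\operatorname{Re}(\varsigma)$, and let $n\in\{1,2,3,\dots\}$. Then: (i) $\displaystyle\left(\frac{d}{d\zeta}\right)^n\mathbb{E}^{\delta}_{\varsigma,\tau}(\zeta)=(\delta)_n\,\mathbb{E}^{\delta+n}_{\varsigma,\tau+n\varsigma}(\zeta)$. (ii) $\displaystyle\left(\zeta\frac{d}{d\zeta}+\delta\right)\mathbb{E}^{\delta}_{\varsigma,\tau}(\zeta)=\delta\,\mathbb{E}^{\delta+1}_{\varsigma,\tau}(\zeta)$. (iii) If $\lambda\in\mathbb{T}$ and $|\operatorname{Im}_j(\tau)|<\operatorname{Re}(\tau)-n$, then $$\left(\frac{d}{d\zeta}\right)^n\left(\zeta^{\tau-1}\,\mathbb{E}^{\delta}_{\varsigma,\tau}(\lambda\zeta^{\varsigma})\right)=\zeta^{\tau-n-1}\,\mathbb{E}^{\delta}_{\varsigma,\tau-n}(\lambda\zeta^{\varsigma}).$$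
   Context: $\mathbb{T}=\{x_0+i_1x_1+i_2x_2+jx_3: x_0,\dots,x_3\in\mathbb{R}\}$ is the commutative algebra of bicomplex numbers, with $i_1^2=i_2^2=-1$, $j=i_1i_2=i_2i_1$, $j^2=1$; write $\operatorname{Re}=x_0$, $\operatorname{Im}_j=x_3$. $\mathbb{C}$ is identified with $\{x_0+i_1x_1\}$. With $e_1=\frac{1+i_1i_2}{2}$, $e_2=\frac{1-i_1i_2}{2}$, every $\xi=w_1+i_2w_2$ ($w_1,w_2\in\mathbb{C}$) is uniquely $\xi=\xi_1e_1+\xi_2e_2$ with $\xi_1=w_1-i_1w_2$, $\xi_2=w_1+i_1w_2\in\mathbb{C}$; algebraic operations, limits and $\Gamma$ are componentwise, $\Gamma(\xi)=\Gamma(\xi_1)e_1+\Gamma(\xi_2)e_2$. The derivative of $f(\zeta)=f_1(\zeta_1)e_1+f_2(\zeta_2)e_2$ with $f_1,f_2$ holomorphic is $\frac{df}{d\zeta}=f_1'(\zeta_1)e_1+f_2'(\zeta_2)e_2$. Powers are $\zeta^{\eta}=\zeta_1^{\eta_1}e_1+\zeta_2^{\eta_2}e_2$ with $\zeta_r^{\eta_r}=\exp(\eta_r\log\zeta_r)$, a single holomorphic branch of $\log\zeta_r$ being used throughout; in (iii) $\zeta$ ranges over points where these branches are defined and holomorphic (in particular $\zeta_1\zeta_2\ne0$). The bicomplex Prabhakar function (for $|\operatorname{Im}_j(\varsigma)|<\operatorname{Re}(\varsigma)$, $|\operatorname{Im}_j(\tau)|<\operatorname{Re}(\tau)$) is $$\mathbb{E}_{\varsigma,\tau}^{\delta}(\zeta)=\sum_{k=0}^{\infty}\frac{(\delta)_k}{k!\,\Gamma(\varsigma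 k+\tau)}\zeta^k,\qquad (\delta)_k=\delta(\delta+1)\cdots(\delta+k-1),\ (\delta)_0=1.$$ *)

(* Defs.v *)
From Stdlib Require Import Reals Factorial Lra.
From Coquelicot Require Import Coquelicot.
Open Scope R_scope.

Definition Cexp (z : C) : C :=
  (exp (fst z) * cos (snd z), exp (fst z) * sin (snd z)).

Fixpoint Crising (z : C) (k : nat) : C :=
  match k with
  | O => RtoC 1
  | S m => (Crising z m * (z + RtoC (INR m)))%C
  end.

(* Euler-Gauss form of Gamma: limit of n! n^z / (z (z+1) ... (z+n)),
   valid at every z that is not a non-positive integer. *)
Definition Cgamma_seq (z : C) (n : nat) : C :=
  (RtoC (INR (fact n)) * Cexp (z * RtoC (ln (INR n))) / Crising z (S n))%C.

Definition Cgamma (z : C) : C :=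
  @iota C_CompleteNormedModule (fun l : C => filterlim (Cgamma_seq z) eventually (locally l)).

Definition CSeries (a : nat -> C) : C :=
  @iota C_CompleteNormedModule (fun s : C => is_series a s).

(* The pair (w1, w2) stands for w1 + i2 w2, where the imaginary unit of C
   is i1; thus x0 + i1 x1 + i2 x2 + j x3 is ((x0, x1), (x2, x3)). *)
Definition bicomplex : Type := (C * C)%type.

Declare Scope bicomplex_scope.
Delimit Scope bicomplex_scope with B.
Bind Scope bicomplex_scope with bicomplex.

Definition bRe (x : bicomplex) : R := fst (fst x).
Definition bIm_j (x : bicomplex) : R := snd (snd x).

Definition bC (z : C) : bicomplex := (z, RtoC 0).
Definition bnat (n : nat) : bicomplex := bC (RtoC (INR n)).
Definition bi2 : bicomplex := (RtoC 0, RtoC 1).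

Definition badd (x y : bicomplex) : bicomplex :=
  (fst x + fst y, snd x + snd y)%C.
Definition bopp (x : bicomplex) : bicomplex := (- fst x, - snd x)%C.
Definition bsub (x y : bicomplex) : bicomplex := badd x (bopp y).
Definition bmul (x y : bicomplex) : bicomplex :=
  (fst x * fst y - snd x * snd y, fst x * snd y + snd x * fst y)%C.

Infix "+" := badd : bicomplex_scope.
Infix "-" := bsub : bicomplex_scope.
Infix "*" := bmul : bicomplex_scope.

Definition be1 : bicomplex := (bC (RtoC (1 / 2)) * (bnat 1 + bC Ci * bi2))%B.
Definition be2 : bicomplex := (bC (RtoC (1 / 2)) * (bnat 1 - bC Ci * bi2))%B.

Definition comp1 (x : bicomplex) : C := (fst x - Ci * snd x)%C.
Definition comp2 (x : bicomplex) : C := (fst x + Ci * snd x)%C.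
Definition idem (z1 z2 : C) : bicomplex := (bC z1 * be1 + bC z2 * be2)%B.

Lemma idem_coords (z1 z2 : C) :
  idem z1 z2 =
  (((fst z1 + fst z2) / 2, (snd z1 + snd z2) / 2),
   ((snd z2 - snd z1) / 2, (fst z1 - fst z2) / 2)).
Proof.
apply injective_projections; apply injective_projections; simpl; lra.
Qed.

Lemma idem_comp (x : bicomplex) : idem (comp1 x) (comp2 x) = x.
Proof.
rewrite idem_coords.
apply injective_projections; apply injective_projections; simpl; lra.
Qed.

Lemma comp1_idem (z1 z2 : C) : comp1 (idem z1 z2) = z1.
Proof.
rewrite idem_coords; apply injective_projections; simpl; lra.
Qed.

Lemma comp2_idem (z1 z2 : C) : comp2 (idem z1 z2) = z2.
Proof.
rewrite idem_coords; apply injective_projections; simpl; lra.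
Qed.

Lemma comp1_mul (x y : bicomplex) : comp1 (x * y)%B = (comp1 x * comp1 y)%C.
Proof.
destruct x as [[a b] [c d]], y as [[a' b'] [c' d']].
apply injective_projections; simpl; ring.
Qed.

Lemma comp2_mul (x y : bicomplex) : comp2 (x * y)%B = (comp2 x * comp2 y)%C.
Proof.
destruct x as [[a b] [c d]], y as [[a' b'] [c' d']].
apply injective_projections; simpl; ring.
Qed.

(* Only meaningful when both components are nonzero. *)
Definition binv (x : bicomplex) : bicomplex :=
  idem (/ comp1 x)%C (/ comp2 x)%C.
Definition bdiv (x y : bicomplex) : bicomplex := (x * binv y)%B.
Infix "/" := bdiv : bicomplex_scope.

Fixpoint bpown (x : bicomplex) (k : nat) : bicomplex :=
  match k with
  | O => bnat 1
  | S m => (x * bpown x m)%B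
  end.

Definition bgamma (x : bicomplex) : bicomplex :=
  idem (Cgamma (comp1 x)) (Cgamma (comp2 x)).

Definition bSeries (a : nat -> bicomplex) : bicomplex :=
  idem (CSeries (fun k => comp1 (a k))) (CSeries (fun k => comp2 (a k))).

Fixpoint bpoch (d : bicomplex) (k : nat) : bicomplex :=
  match k with
  | O => bnat 1
  | S m => (bpoch d m * (d + bnat m))%B
  end.

Definition prabhakar (delta sigma tau zeta : bicomplex) : bicomplex :=
  bSeries (fun k =>
    (bpoch delta k / (bnat (fact k) * bgamma (sigma * bnat k + tau))
       * bpown zeta k)%B).

(* [is_bderive f z l]: near z, f = f1(zeta_1) e1 + f2(zeta_2) e2 with f1, f2
   holomorphic, and f1'(z_1) e1 + f2'(z_2) e2 = l. *)
Definition is_bderive (f : bicomplex -> bicomplex) (z l : bicomplex) : Prop :=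
  exists f1 f2 : C -> C,
    locally z (fun x : bicomplex => f x = idem (f1 (comp1 x)) (f2 (comp2 x))) /\
    locally (comp1 z) (fun w : C => ex_derive f1 w) /\
    locally (comp2 z) (fun w : C => ex_derive f2 w) /\
    exists l1 l2 : C,
      is_derive f1 (comp1 z) l1 /\ is_derive f2 (comp2 z) l2 /\ l = idem l1 l2.

Fixpoint is_bderive_n (n : nat) (f : bicomplex -> bicomplex)
    (z l : bicomplex) : Prop :=
  match n with
  | O => f z = l
  | S m => exists g : bicomplex -> bicomplex,
      locally z (fun x : bicomplex => is_bderive_n m f x (g x)) /\
      is_bderive g z l
  end.

Definition log_branch (U : C -> Prop) (L : C -> C) : Prop :=
  open U /\ forall z : C, U z -> Cexp (L z) = z /\ ex_derive L z.

(* zeta^eta, computed with the branches L1, L2 of log zeta_1, log zeta_2. *)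
Definition bpow (L1 L2 : C -> C) (zeta eta : bicomplex) : bicomplex :=
  idem (Cexp (comp1 eta * L1 (comp1 zeta)))
       (Cexp (comp2 eta * L2 (comp2 zeta))).

(* Main.v *)
(* The idempotent components turn every claim into one about the complex
   function E(z) = sum (d)_k z^k / (k! Gamma(s k + t)) with Re s, Re t > 0.

   Gauss's sequence converges because its relative increments are O(1/n^2), and
   its limit satisfies Gamma(z + 1) = z Gamma(z).  In the product
   z (z+1) ... (z+n), the factors with index at most J are bounded crudely and
   the later ones by |1 + z/j| <= exp(Re z / j + |z|^2 / (2 j^2)); this gives
   |Gamma(z)| >= exp(Re z * ln J - 4 J) whenever |z| <= J.  Taking J
   proportional to k makes the coefficients of E decay faster than any geometric
   sequence, so E is entire and can be differentiated term by term.  All three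
   identities are then identities between coefficients: (i) and (ii) from
   d (d+1)_k = (d)_{k+1} = (d)_k (d+k), and (iii) from
   (s k + t - 1) / Gamma(s k + t) = 1 / Gamma(s k + t - 1). *)

Require Import Defs.
From Stdlib Require Import Reals Lra Lia Factorial FunctionalExtensionality.
From Coquelicot Require Import Coquelicot.
Open Scope R_scope.

(** * Complex exponential and derivatives *)

Lemma Cmod_le_abs_add (x y : R) : Cmod (x, y) <= Rabs x + Rabs y.
Proof.
replace ((x, y) : C) with (RtoC x + RtoC y * Ci)%C
  by (apply injective_projections; simpl; ring).
eapply Rle_trans; [apply Cmod_triangle|].
rewrite Cmod_mult, !Cmod_R, Cmod_Ci; lra.
Qed.

Lemma Rabs_im_le_Cmod (z : C) : Rabs (snd z) <= Cmod z.
Proof.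
eapply Rle_trans; [apply Rmax_r|apply Rmax_Cmod].
Qed.

Lemma Rabs_re_le_Cmod (z : C) : Rabs (fst z) <= Cmod z.
Proof.
eapply Rle_trans; [apply Rmax_l|apply Rmax_Cmod].
Qed.

Lemma Cexp_add (z w : C) : Cexp (z + w) = (Cexp z * Cexp w)%C.
Proof.
unfold Cexp; simpl; rewrite exp_plus, cos_plus, sin_plus.
apply injective_projections; simpl; ring.
Qed.

Lemma Cexp_RtoC (x : R) : Cexp (RtoC x) = RtoC (exp x).
Proof.
unfold Cexp; simpl; rewrite cos_0, sin_0.
apply injective_projections; simpl; ring.
Qed.

Lemma Cmod_Cexp (z : C) : Cmod (Cexp z) = exp (fst z).
Proof.
assert (H := exp_pos (fst z)).
assert (T := sin2_cos2 (snd z)); unfold Rsqr in T.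
apply Rsqr_inj; [apply Cmod_ge_0|lra|].
unfold Rsqr; replace (Cmod (Cexp z) * Cmod (Cexp z)) with (Cmod (Cexp z) ^ 2) by ring.
rewrite Cmod2_alt; unfold Re, Im; unfold Cexp; simpl.
replace (_ + _) with (exp (fst z) * exp (fst z) *
  (sin (snd z) * sin (snd z) + cos (snd z) * cos (snd z))) by ring.
rewrite T; ring.
Qed.

(** Both sides come from [1 + x <= exp x]. Used at [- x] it gives [exp x * (1 - x) <= 1], and
    [1 / (1 - x) = 1 + x + x ^ 2 / (1 - x)], where [1 - x] is at least 1/2. *)
Lemma Rabs_exp_quadratic (x : R) :
  Rabs x <= 1 / 2 -> Rabs (exp x - 1 - x) <= 2 * x ^ 2.
Proof.
intros Hx; apply Rabs_le_between in Hx.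
assert (H1 := exp_ineq1_le x); assert (H2 := exp_ineq1_le (- x)).
assert (H3 : exp x * exp (- x) = 1) by (rewrite <- exp_plus, Rplus_opp_r; apply exp_0).
assert (H4 := exp_pos x).
apply Rabs_le; split; [nra|].
assert (exp x * (1 - x) <= 1) by nra.
nra.
Qed.

Lemma Rabs_sin_le (x : R) : Rabs (sin x) <= Rabs x.
Proof.
assert (P : forall y, 0 <= y -> Rabs (sin y) <= y).
{ intros y Hy.
  destruct (Req_dec y 0) as [->|Hy0]; [rewrite sin_0, Rabs_R0; lra|].
  assert (H1 := sin_lt_x y ltac:(lra)).
  apply Rabs_le; split; [|lra].
  (* Up to 1, which is below [PI / 2], the sine is positive; beyond 1 the bound by 1 on its absolute
     value suffices. *)
  destruct (Rle_dec y 1) as [Hy1|Hy1].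
  - assert (0 < sin y); [|lra].
    apply sin_gt_0; [lra|]; assert (H2 := PI2_1); lra.
  - assert (H2 := SIN_bound y); lra. }
destruct (Rle_dec 0 x) as [Hx|Hx].
- rewrite (Rabs_pos_eq x Hx); auto.
- rewrite <- (Rabs_Ropp x), <- (Rabs_Ropp (sin x)), <- sin_neg.
  rewrite (Rabs_pos_eq (- x)) by lra; apply P; lra.
Qed.

Lemma Rabs_cos_sub1_le (x : R) : Rabs (cos x - 1) <= x ^ 2 / 2.
Proof.
replace x with (2 * (x / 2)) at 1 by field.
rewrite cos_2a_sin.
assert (H := Rabs_sin_le (x / 2)); apply Rsqr_le_abs_1 in H; unfold Rsqr in H.
apply Rabs_le; nra.
Qed.

(** By the mean value theorem [sin x - x = (cos c - 1) * x] with [c] between 0 and [x]. The first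
    factor is at most [x ^ 2 / 2] in absolute value, and [Rabs x <= 1] absorbs the second. *)
Lemma Rabs_sin_sub_le (x : R) : Rabs x <= 1 -> Rabs (sin x - x) <= x ^ 2.
Proof.
intros Hx.
destruct (MVT_gen sin 0 x cos) as [c [Hc Hs]].
- intros; apply is_derive_sin.
- intros; apply continuity_sin.
- rewrite sin_0 in Hs.
  replace (sin x - x) with ((cos c - 1) * x) by lra.
  rewrite Rabs_mult.
  assert (Hcx : c ^ 2 <= x ^ 2).
  { unfold Rmin, Rmax in Hc; destruct (Rle_dec 0 x); nra. }
  assert (H := Rabs_cos_sub1_le c).
  assert (H2 := Rabs_pos x); assert (H3 := Rabs_pos (cos c - 1)).
  nra.
Qed.

(** This remainder bound yields both the derivative of [Cexp] and the size of the increments of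
    Gauss's sequence. The real and imaginary parts are split into one-variable remainders; their
    bounds [y ^ 2 + 2 * x ^ 2] and [x ^ 2 + 2 * y ^ 2] add up to three times the squared modulus. *)
Lemma Cmod_Cexp_quadratic (w : C) :
  Cmod w <= 1 / 2 -> Cmod (Cexp w - 1 - w) <= 4 * Cmod w ^ 2.
Proof.
intros Hw.
assert (Hx := Rabs_re_le_Cmod w); assert (Hy := Rabs_im_le_Cmod w).
rewrite Cmod2_alt; unfold Re, Im; destruct w as [x y]; simpl fst in *; simpl snd in *.
assert (Hx' : Rabs x <= 1 / 2) by lra; assert (Hy' : Rabs y <= 1) by lra.
assert (E := Rabs_exp_quadratic x Hx').
assert (S := Rabs_sin_sub_le y Hy'); assert (S1 := Rabs_sin_le y).
assert (K := Rabs_cos_sub1_le y).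
assert (E2 : 0 < exp x <= 2).
{ split; [apply exp_pos|].
  apply Rabs_le_between in E; apply Rabs_le_between in Hx'; nra. }
assert (E1 : Rabs (exp x - 1) <= 2 * Rabs x).
{ replace (exp x - 1) with ((exp x - 1 - x) + x) by ring.
  eapply Rle_trans; [apply Rabs_triang|].
  rewrite <- (pow2_abs x) in E; assert (Hp := Rabs_pos x); nra. }
replace (Cexp (x, y) - 1 - (x, y))%C
  with ((exp x * (cos y - 1) + (exp x - 1 - x),
         (exp x - 1) * sin y + (sin y - y)) : C)
  by (apply injective_projections; unfold Cexp; simpl; ring).
eapply Rle_trans; [apply Cmod_le_abs_add|].
assert (A : Rabs (exp x * (cos y - 1) + (exp x - 1 - x)) <= y ^ 2 + 2 * x ^ 2).
{ eapply Rle_trans; [apply Rabs_triang|].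
  rewrite Rabs_mult, (Rabs_pos_eq (exp x)) by lra.
  assert (Hp := Rabs_pos (cos y - 1)); nra. }
assert (B : Rabs ((exp x - 1) * sin y + (sin y - y)) <= x ^ 2 + 2 * y ^ 2).
{ eapply Rle_trans; [apply Rabs_triang|].
  rewrite Rabs_mult.
  assert (P : Rabs (exp x - 1) * Rabs (sin y) <= (2 * Rabs x) * Rabs y)
    by (apply Rmult_le_compat; auto using Rabs_pos).
  assert (Q := pow2_ge_0 (Rabs x - Rabs y)).
  assert (Qx := pow2_abs x); assert (Qy := pow2_abs y); nra. }
nra.
Qed.

(** * Complex derivatives *)

(** An error quadratic in [h] on a fixed disc is o(|h|). This is the form in which [Cexp] and entire
    power series are differentiated. *)
Lemma is_derive_C_quadratic (f : C -> C) (z l : C) (r c : R) :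
  0 < r -> 0 <= c ->
  (forall h : C, Cmod h < r -> Cmod (f (z + h) - f z - h * l)%C <= c * Cmod h ^ 2) ->
  is_derive f z l.
Proof.
intros Hr Hc H; split; [apply (is_linear_scal_l (K := C_AbsRing) (V := C_NormedModule))|].
intros x Hx.
(* Differentiability is stated at every limit [x] of the neighbourhood filter of [z]; the only such
   limit is [z]. *)
apply (is_filter_lim_locally_unique (K := C_AbsRing) (V := AbsRing_NormedModule C_AbsRing)) in Hx.
subst x; intros eps.
(* Dividing by [c + 1] instead of [c] covers the case [c = 0]. *)
assert (Hd : 0 < Rmin r (eps / (c + 1))).
{ apply Rmin_pos; [exact Hr|]; apply Rdiv_lt_0_compat; [apply eps|lra]. }
exists (mkposreal _ Hd); intros y Hy.
change (Cmod (y - z)%C < Rmin r (eps / (c + 1))) in Hy.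
change (Cmod ((f y - f z) - (y - z) * l)%C <= eps * Cmod (y - z)%C).
assert (Hh := H (y - z)%C ltac:(eapply Rlt_le_trans; [exact Hy|apply Rmin_l])).
assert (HC : forall a b : C, (a + (b - a))%C = b) by (intros; ring).
rewrite HC in Hh; clear HC.
eapply Rle_trans; [exact Hh|].
assert (Hy2 : Cmod (y - z) < eps / (c + 1)) by (eapply Rlt_le_trans; [exact Hy|apply Rmin_r]).
assert (Hm := Cmod_ge_0 (y - z)).
assert (E := cond_pos eps).
apply (Rmult_lt_compat_r (c + 1)) in Hy2; [|lra].
unfold Rdiv in Hy2; rewrite Rmult_assoc, Rinv_l, Rmult_1_r in Hy2 by lra.
simpl; nra.
Qed.

Lemma is_derive_Cexp (z : C) : is_derive Cexp z (Cexp z).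
Proof.
apply is_derive_C_quadratic with (r := 1 / 2) (c := Cmod (Cexp z) * 4); [lra| |].
- assert (H := Cmod_ge_0 (Cexp z)); lra.
- intros h Hh.
  rewrite Cexp_add.
  replace (Cexp z * Cexp h - Cexp z - h * Cexp z)%C
    with (Cexp z * (Cexp h - 1 - h))%C by ring.
  rewrite Cmod_mult, Rmult_assoc.
  apply Rmult_le_compat_l; [apply Cmod_ge_0|].
  apply Cmod_Cexp_quadratic; lra.
Qed.

(* [C_NormedModule] and [AbsRing_NormedModule C_AbsRing] carry different
   uniform structures; derivatives agree since only the norm matters. *)
Lemma is_derive_C_AbsRing (f : C -> C) (z l : C) :
  is_derive (V := C_NormedModule) f z l <->
  @is_derive C_AbsRing (AbsRing_NormedModule C_AbsRing) f z l.
Proof.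
split; intros H; split.
- apply is_linear_scal_l.
- apply H.
- apply (is_linear_scal_l (K := C_AbsRing) (V := C_NormedModule)).
- apply H.
Qed.

Lemma is_derive_C_mult (f g : C -> C) (z df dg : C) :
  is_derive f z df -> is_derive g z dg ->
  is_derive (fun x => f x * g x)%C z (df * g z + f z * dg)%C.
Proof.
intros Hf Hg; apply is_derive_C_AbsRing.
apply is_derive_C_AbsRing in Hf; apply is_derive_C_AbsRing in Hg.
exact (is_derive_mult (K := C_AbsRing) f g z df dg Hf Hg Cmult_comm).
Qed.

Lemma is_derive_C_comp (f g : C -> C) (z df dg : C) :
  is_derive f (g z) df -> is_derive g z dg ->
  is_derive (fun x => f (g x)) z (dg * df)%C.
Proof.
intros Hf Hg; apply is_derive_C_AbsRing in Hg.
exact (is_derive_comp f g z df dg Hf Hg).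
Qed.

Lemma is_derive_C_const_mult (c : C) (f : C -> C) (z df : C) :
  is_derive f z df -> is_derive (fun x => c * f x)%C z (c * df)%C.
Proof.
intros Hf; assert (H := is_derive_C_mult (fun _ => c) f z 0 df).
replace (c * df)%C with (0 * f z + c * df)%C by ring.
apply H; [|exact Hf].
exact (is_derive_const (K := C_AbsRing) (V := C_NormedModule) c z).
Qed.

Lemma is_derive_C_unique (f : C -> C) (z l l' : C) :
  is_derive f z l -> is_derive f z l' -> l = l'.
Proof.
intros H H'; apply is_C_derive_unique in H; apply is_C_derive_unique in H'; congruence.
Qed.

(** * The Gamma limit *)

Lemma exp_monotone (x y : R) : x <= y -> exp x <= exp y.
Proof.
intros [H| ->]; [apply Rlt_le, exp_increasing, H|apply Rle_refl].
Qed.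

(** The balls of [C_UniformSpace] are squares, whereas all estimates here are in terms of [Cmod].
    This lemma and its converse pass between the two. *)
Lemma filterlim_C_of_Cmod (u : nat -> C) (l : C) :
  is_lim_seq (fun n => Cmod (u n - l)%C) 0 ->
  filterlim u eventually (locally (l : C_UniformSpace)).
Proof.
intros H; apply filterlim_locally; intros eps.
apply is_lim_seq_spec in H; destruct (H eps) as [N HN].
exists N; intros n Hn; apply C_NormedModule_mixin_compat1.
change (Cmod (u n - l)%C < eps).
specialize (HN n Hn); rewrite Rminus_0_r, Rabs_pos_eq in HN by apply Cmod_ge_0.
exact HN.
Qed.

Lemma Cmod_of_filterlim_C (u : nat -> C) (l : C) :
  filterlim u eventually (locally (l : C_UniformSpace)) ->
  is_lim_seq (fun n => Cmod (u n - l)%C) 0.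
Proof.
intros H; apply is_lim_seq_spec; intros eps.
(* A square of half-side [r] lies in the disc of radius [sqrt 2 * r], so the square has to be
   smaller than [eps] by this factor. *)
assert (S2 : 0 < sqrt 2) by (apply sqrt_lt_R0; lra).
assert (He : 0 < eps / sqrt 2) by (apply Rdiv_lt_0_compat; [apply eps|lra]).
destruct (proj1 (filterlim_locally (U := C_UniformSpace) u l) H (mkposreal _ He)) as [N HN].
exists N; intros n Hn; specialize (HN n Hn).
apply (C_NormedModule_mixin_compat2 l (u n) (mkposreal _ He)) in HN.
change (Cmod (u n - l)%C < sqrt 2 * (eps / sqrt 2)) in HN.
rewrite Rminus_0_r, Rabs_pos_eq by apply Cmod_ge_0.
replace (sqrt 2 * (eps / sqrt 2)) with (pos eps) in HN by (field; lra).
exact HN.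
Qed.

Lemma is_lim_seq_Cmod (u : nat -> C) (l : C) :
  filterlim u eventually (locally (l : C_UniformSpace)) ->
  is_lim_seq (fun n => Cmod (u n)) (Cmod l).
Proof.
intros H; apply Cmod_of_filterlim_C in H.
apply (is_lim_seq_le_le
  (fun n => Cmod l - Cmod (u n - l)%C) _ (fun n => Cmod l + Cmod (u n - l)%C)).
- intros n; split.
  + assert (T := Cmod_triangle (u n) (- (u n - l))).
    rewrite Cmod_opp in T; replace (u n + - (u n - l))%C with l in T by ring; lra.
  + assert (T := Cmod_triangle l (u n - l)).
    replace (l + (u n - l))%C with (u n) in T by ring; lra.
- replace (Finite (Cmod l)) with (Finite (Cmod l - 0)) by (f_equal; ring).
  apply is_lim_seq_minus'; [apply is_lim_seq_const|exact H].
- replace (Finite (Cmod l)) with (Finite (Cmod l + 0)) by (f_equal; ring).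
  apply is_lim_seq_plus'; [apply is_lim_seq_const|exact H].
Qed.

Lemma ex_series_C_le (a : nat -> C) (b : nat -> R) :
  (forall n, Cmod (a n) <= b n) -> ex_series b ->
  ex_series (V := C_NormedModule) a.
Proof.
intros H Hb; exact (ex_series_le (V := C_CompleteNormedModule) a b H Hb).
Qed.

(** The terms telescope as [1 / (n + 1) - 1 / (n + 2)], so the sum is 1. *)
Lemma ex_series_inv_mul_succ :
  ex_series (fun n => / ((INR n + 1) * (INR n + 2))).
Proof.
exists 1; apply is_series_Reals; intros eps He.
destruct (archimed_cor1 eps He) as [N [HN HN0]].
exists N; intros n Hn.
assert (S : sum_f_R0 (fun n => / ((INR n + 1) * (INR n + 2))) n = 1 - / (INR n + 2)).
{ clear; induction n as [|n IH]; [simpl; field|].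
  rewrite tech5, IH, S_INR; assert (H := pos_INR n); field; lra. }
rewrite S; unfold Rdist.
replace (1 - / (INR n + 2) - 1) with (- / (INR n + 2)) by ring.
assert (H := pos_INR n); apply le_INR in Hn; apply lt_INR in HN0; simpl in HN0.
rewrite Rabs_Ropp, Rabs_pos_eq by (apply Rlt_le, Rinv_0_lt_compat; lra).
eapply Rle_lt_trans; [|exact HN].
apply Rinv_le_contravar; lra.
Qed.

(* The relative increments [c / ((n+1)(n+2))] telescope, so
   [|u n| <= |u 0| exp (c (1 - 1/(n+1)))]. *)
Lemma bounded_of_small_increments (u : nat -> C) (c : R) (n : nat) :
  0 <= c ->
  (forall n, Cmod (u (S n) - u n)%C <= c / ((INR n + 1) * (INR n + 2)) * Cmod (u n)) ->
  Cmod (u n) <= Cmod (u O) * exp (c * (1 - / (INR n + 1))).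
Proof.
intros Hc H; induction n as [|n IH].
- simpl; replace (c * _) with 0 by field; rewrite exp_0; lra.
- assert (Hn := pos_INR n).
  set (d := c / ((INR n + 1) * (INR n + 2))) in *.
  replace (c * (1 - / (INR (S n) + 1))) with (c * (1 - / (INR n + 1)) + d)
    by (rewrite S_INR; unfold d; field; lra).
  rewrite exp_plus, <- Rmult_assoc.
  assert (T := Cmod_triangle (u n) (u (S n) - u n)).
  replace (u n + (u (S n) - u n))%C with (u (S n)) in T by ring.
  specialize (H n); fold d in H.
  assert (E := exp_ineq1_le d).
  assert (M := Cmod_ge_0 (u n)); assert (P := exp_pos d).
  apply Rle_trans with (Cmod (u n) * exp d); [nra|].
  apply Rmult_le_compat_r; lra.
Qed.

(** Boundedness of [u] turns the relative bound on the increments into a summable absolute one. The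
    series of increments then converges, and its partial sums are [u (S n) - u O]. *)
Lemma converges_of_small_increments (u : nat -> C) (c : R) :
  0 <= c ->
  (forall n, Cmod (u (S n) - u n)%C <= c / ((INR n + 1) * (INR n + 2)) * Cmod (u n)) ->
  exists l : C, filterlim u eventually (locally (l : C_UniformSpace)).
Proof.
intros Hc H.
assert (X : ex_series (V := C_NormedModule) (fun n => u (S n) - u n)%C).
{ apply ex_series_C_le with
    (fun n => (Cmod (u O) * exp c * c) * / ((INR n + 1) * (INR n + 2))).
  - intros n; eapply Rle_trans; [apply H|].
    assert (Hn := pos_INR n).
    assert (P : 0 < / ((INR n + 1) * (INR n + 2)))
      by (apply Rinv_0_lt_compat; nra).
    assert (B : Cmod (u n) <= Cmod (u O) * exp c).
    { eapply Rle_trans; [apply (bounded_of_small_increments u c n Hc H)|].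
      apply Rmult_le_compat_l; [apply Cmod_ge_0|].
      assert (Q : 0 < / (INR n + 1)) by (apply Rinv_0_lt_compat; lra).
      apply exp_monotone; nra. }
    unfold Rdiv.
    replace (c * / ((INR n + 1) * (INR n + 2)) * Cmod (u n))
      with (Cmod (u n) * (c * / ((INR n + 1) * (INR n + 2)))) by ring.
    rewrite Rmult_assoc; apply Rmult_le_compat_r; [nra|exact B].
  - apply (ex_series_scal (K := R_AbsRing) (V := R_NormedModule)).
    exact ex_series_inv_mul_succ. }
destruct X as [s Hs]; exists (s + u O)%C.
apply filterlim_C_of_Cmod, is_lim_seq_incr_1.
apply (Cmod_of_filterlim_C (sum_n (fun n => u (S n) - u n)%C) s) in Hs.
apply is_lim_seq_ext with (2 := Hs); intros n.
assert (S : sum_n (fun n => u (S n) - u n)%C n = (u (S n) - u O)%C).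
{ induction n as [|n IH]; [rewrite sum_O; reflexivity|].
  rewrite sum_Sn, IH; change plus with Cplus; simpl; ring. }
rewrite S; f_equal; ring.
Qed.

Lemma filterlim_C_shift (u : nat -> C) (l : C) (N : nat) :
  filterlim (fun n => u (n + N)%nat) eventually (locally (l : C_UniformSpace)) ->
  filterlim u eventually (locally (l : C_UniformSpace)).
Proof.
intros H; apply Cmod_of_filterlim_C in H; apply filterlim_C_of_Cmod.
apply (is_lim_seq_incr_n _ N); exact H.
Qed.

Lemma Cmod_RtoC_pos (x : R) : 0 <= x -> Cmod (RtoC x) = x.
Proof.
intros H; rewrite Cmod_R; apply Rabs_pos_eq, H.
Qed.

(** * Rising factorials and Gauss's sequence *)

Lemma Cmod_add_nat_ge (z : C) (k : nat) :
  0 < fst z -> INR k < Cmod (z + RtoC (INR k)).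
Proof.
intros Hz; eapply Rlt_le_trans; [|apply Rabs_re_le_Cmod].
simpl; eapply Rlt_le_trans; [|apply Rle_abs]; lra.
Qed.

Lemma add_nat_neq_0 (z : C) (k : nat) :
  0 < fst z -> (z + RtoC (INR k))%C <> 0%C.
Proof.
intros Hz; apply Cmod_gt_0.
eapply Rle_lt_trans; [apply pos_INR|apply Cmod_add_nat_ge, Hz].
Qed.

Lemma Crising_neq_0 (z : C) (k : nat) : 0 < fst z -> Crising z k <> 0%C.
Proof.
intros Hz; induction k as [|k IH]; simpl.
- intros E; injection E; lra.
- apply Cmult_neq_0; [exact IH|apply add_nat_neq_0, Hz].
Qed.

(** Splitting off the first factor instead of the last. The functional equation of Gamma and the
    coefficient identities for raising [d] to [d + 1] both rest on it. *)
Lemma Crising_shift (z : C) (k : nat) :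
  (z * Crising (z + 1) k)%C = Crising z (S k).
Proof.
induction k as [|k IH].
- simpl; ring.
- change (Crising (z + 1) (S k)) with (Crising (z + 1) k * (z + 1 + RtoC (INR k)))%C.
  change (Crising z (S (S k))) with (Crising z (S k) * (z + RtoC (INR (S k))))%C.
  rewrite Cmult_assoc, IH, S_INR, RtoC_plus; ring.
Qed.

(** Both bounds are [ln t <= t - 1], taken at [t = n / (n + 1)] and at [t = (n + 1) / n]. *)
Lemma ln_succ_bounds (n : nat) :
  (1 <= n)%nat ->
  / INR (S n) <= ln (INR (S n)) - ln (INR n) <= / INR n.
Proof.
intros Hn; apply le_INR in Hn; simpl in Hn; rewrite S_INR.
assert (L : forall x y, 0 < x -> 0 < y -> ln x - ln y <= x / y - 1).
{ intros x y Hx Hy; rewrite <- ln_div by lra.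
  assert (E := exp_ineq1_le (ln (x / y))).
  rewrite exp_ln in E by (apply Rdiv_lt_0_compat; lra); lra. }
split.
- assert (H := L (INR n) (INR n + 1) ltac:(lra) ltac:(lra)).
  replace (INR n / (INR n + 1) - 1) with (- / (INR n + 1)) in H by (field; lra); lra.
- assert (H := L (INR n + 1) (INR n) ltac:(lra) ltac:(lra)).
  replace ((INR n + 1) / INR n - 1) with (/ INR n) in H by (field; lra); lra.
Qed.

(** The identity is algebraic: the term [ln (INR n)] cancels, so it also holds at [n = 0], where
    that logarithm is only a default value. *)
Lemma Cgamma_seq_succ (z : C) (n : nat) :
  0 < fst z ->
  Cgamma_seq z (S n) =
  (Cgamma_seq z n * (RtoC (INR (S n)) * Cexp (z * RtoC (ln (INR (S n)) - ln (INR n)))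
     / (z + RtoC (INR (S n)))))%C.
Proof.
intros Hz; unfold Cgamma_seq.
replace (z * RtoC (ln (INR (S n))))%C
  with (z * RtoC (ln (INR n)) + z * RtoC (ln (INR (S n)) - ln (INR n)))%C
  by (rewrite RtoC_minus; ring).
rewrite Cexp_add, fact_simpl, mult_INR, RtoC_mult.
change (Crising z (S (S n))) with (Crising z (S n) * (z + RtoC (INR (S n))))%C.
field; split.
- apply add_nat_neq_0, Hz.
- apply (Crising_neq_0 z (S n) Hz).
Qed.

(** With [N = n + 1] and [d = ln N - ln n], the relative increment is [(N (exp (z d) - 1 - z d) + z
    (N d - 1)) / (z + N)]. Since [d] lies between [1 / N] and [1 / n], both summands of the
    numerator are O(1/n), and the denominator exceeds [N] in modulus. The condition
    [2 * Cmod z <= INR n] ensures [|z d| <= 1 / 2], as the exponential estimate requires. *)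
Lemma Cgamma_seq_increment (z : C) (n : nat) :
  0 < fst z -> (1 <= n)%nat -> 2 * Cmod z <= INR n ->
  Cmod (Cgamma_seq z (S n) - Cgamma_seq z n)%C <=
  (8 * Cmod z ^ 2 + Cmod z) / (INR n * (INR n + 1)) * Cmod (Cgamma_seq z n).
Proof.
intros Hz Hn Hzn.
assert (Hn1 : 1 <= INR n) by (apply le_INR in Hn; exact Hn).
rewrite Cgamma_seq_succ by exact Hz.
destruct (ln_succ_bounds n Hn) as [D1 D2].
set (d := ln (INR (S n)) - ln (INR n)) in *.
assert (HS : INR (S n) = INR n + 1) by apply S_INR.
assert (Hnz := add_nat_neq_0 z (S n) Hz).
assert (Hge := Cmod_add_nat_ge z (S n) Hz).
set (N := INR (S n)) in *.
replace (Cgamma_seq z n * (N * Cexp (z * d) / (z + N)) - Cgamma_seq z n)%C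
  with ((RtoC N * (Cexp (z * d) - 1 - z * d) + z * RtoC (N * d - 1)) / (z + RtoC N)
        * Cgamma_seq z n)%C
  by (rewrite RtoC_minus, RtoC_mult; field; exact Hnz).
rewrite Cmod_mult; apply Rmult_le_compat_r; [apply Cmod_ge_0|].
rewrite Cmod_div by exact Hnz.
assert (I1 : 0 < / N) by (apply Rinv_0_lt_compat; lra).
assert (I2 : 0 < / INR n) by (apply Rinv_0_lt_compat; lra).
assert (EN : N * / N = 1) by (apply Rinv_r; lra).
assert (En : INR n * / INR n = 1) by (apply Rinv_r; lra).
assert (Mz := Cmod_ge_0 z).
assert (Hd : 0 <= d) by lra.
assert (Mzd : Cmod (z * d) = Cmod z * d) by (rewrite Cmod_mult, Cmod_RtoC_pos; auto).
assert (Hhalf : Cmod (z * d) <= 1 / 2).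
{ rewrite Mzd; apply Rle_trans with (Cmod z * / INR n); [apply Rmult_le_compat_l; lra|nra]. }
assert (Q := Cmod_Cexp_quadratic _ Hhalf); rewrite Mzd in Q.
assert (Dsq : (Cmod z * d) ^ 2 <= Cmod z ^ 2 * (/ INR n) ^ 2).
{ rewrite Rpow_mult_distr; apply Rmult_le_compat_l; [apply pow2_ge_0|].
  apply pow_incr; lra. }
assert (Nd : 0 <= N * d - 1 <= / INR n).
{ split; [nra|]. assert (N * d <= N * / INR n) by (apply Rmult_le_compat_l; lra).
  rewrite HS in *; nra. }
apply Rle_trans with ((N * (4 * (Cmod z ^ 2 * (/ INR n) ^ 2)) + Cmod z * / INR n) / N).
- assert (Hnum : Cmod (RtoC N * (Cexp (z * d) - 1 - z * d) + z * RtoC (N * d - 1))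
     <= N * (4 * (Cmod z ^ 2 * (/ INR n) ^ 2)) + Cmod z * / INR n).
  { eapply Rle_trans; [apply Cmod_triangle|].
    rewrite !Cmod_mult, !Cmod_RtoC_pos by lra.
    apply Rplus_le_compat; apply Rmult_le_compat_l; lra. }
  apply Rmult_le_compat; [apply Cmod_ge_0| |exact Hnum|].
  + apply Rlt_le, Rinv_0_lt_compat; lra.
  + apply Rinv_le_contravar; lra.
- rewrite <- HS.
  (* Replacing one factor [1 / n] by [2 / N] turns the constant 4 of the exponential estimate into
     8. *)
  assert (P2 : / INR n <= 2 * / N).
  { apply (Rmult_le_reg_r (INR n * N)); [nra|].
    replace (/ INR n * (INR n * N)) with N by (field; lra).
    replace (2 * / N * (INR n * N)) with (2 * INR n) by (field; lra). lra. }
  replace ((N * (4 * (Cmod z ^ 2 * (/ INR n) ^ 2)) + Cmod z * / INR n) / N)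
    with (4 * Cmod z ^ 2 * (/ INR n * / INR n) + Cmod z * (/ INR n * / N)) by (field; lra).
  replace ((8 * Cmod z ^ 2 + Cmod z) / (INR n * N))
    with (4 * Cmod z ^ 2 * (/ INR n * (2 * / N)) + Cmod z * (/ INR n * / N)) by (field; lra).
  apply Rplus_le_compat_r, Rmult_le_compat_l; [nra|].
  apply Rmult_le_compat_l; lra.
Qed.

(** [Cgamma] is chosen by [iota], so it is the limit as soon as some limit exists. Existence comes
    from the O(1/n^2) relative increments of a tail of the sequence. *)
Lemma Cgamma_seq_cv (z : C) :
  0 < fst z ->
  filterlim (Cgamma_seq z) eventually (locally (Cgamma z : C_UniformSpace)).
Proof.
intros Hz.
assert (X : exists l : C, filterlim (Cgamma_seq z) eventually (locally (l : C_UniformSpace))).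
(* The tail starts at some [N > 1 + 2 * Cmod z], from where on the increment bound applies. *)
{ destruct (archimed_cor1 (/ (1 + 2 * Cmod z))) as [N [HN HN0]].
  { assert (H := Cmod_ge_0 z); apply Rinv_0_lt_compat; lra. }
  assert (Mz := Cmod_ge_0 z).
  assert (HNr : 0 < INR N) by (apply lt_0_INR; lia).
  apply Rinv_lt_cancel in HN; [|lra].
  destruct (converges_of_small_increments (fun n => Cgamma_seq z (n + N)%nat)
    (2 * (8 * Cmod z ^ 2 + Cmod z))) as [l Hl].
  - nra.
  - intros n; change (S n + N)%nat with (S (n + N)).
    assert (Hn := pos_INR n).
    assert (HN1 : 1 <= INR N) by (apply (le_INR 1); lia).
    eapply Rle_trans; [apply Cgamma_seq_increment; [exact Hz|lia|rewrite plus_INR; lra]|].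
    apply Rmult_le_compat_r; [apply Cmod_ge_0|].
    rewrite plus_INR.
    unfold Rdiv; rewrite (Rmult_comm 2), Rmult_assoc; apply Rmult_le_compat_l; [nra|].
    replace (2 * / ((INR n + 1) * (INR n + 2))) with (/ ((INR n + 1) * (INR n + 2) / 2))
      by (field; lra).
    apply Rinv_le_contravar; nra.
  - exists l; exact (filterlim_C_shift _ l N Hl). }
destruct X as [l Hl].
replace (Cgamma z) with l; [exact Hl|symmetry].
exact (iota_filterlim_locally (V := C_CompleteNormedModule) (Cgamma_seq z) l Hl).
Qed.

(** Gauss's sequence at [z + 1] is the one at [z] times [z * n / (z + 1 + n)], and [n / (z + 1 + n)]
    tends to 1. *)
Lemma Cgamma_succ (z : C) : 0 < fst z -> Cgamma (z + 1) = (z * Cgamma z)%C.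
Proof.
intros Hz.
assert (Hz1 : 0 < fst (z + 1)%C) by (simpl; lra).
apply (filterlim_locally_unique (V := C_NormedModule) (F := eventually) (Cgamma_seq (z + 1)));
  [exact (Cgamma_seq_cv _ Hz1)|].
assert (L := Cgamma_seq_cv z Hz); apply Cmod_of_filterlim_C in L.
(* Shifting to the index [S n] makes [exp (ln (INR (S n))) = INR (S n)] available. *)
apply filterlim_C_of_Cmod, is_lim_seq_incr_1.
assert (Mz := Cmod_ge_0 z); assert (MG := Cmod_ge_0 (Cgamma z)).
apply is_lim_seq_le_le with (u := fun _ => 0) (w := fun n =>
  Cmod z * (Cmod (Cgamma_seq z (S n) - Cgamma z) +
            Cmod (Cgamma z) * Cmod (z + 1) * / INR (S n))).
- intros n; split; [apply Cmod_ge_0|].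
  assert (HN : 0 < INR (S n)) by (apply lt_0_INR; lia).
  assert (Hnz := add_nat_neq_0 (z + 1) (S n) Hz1).
  assert (Hge := Cmod_add_nat_ge (z + 1) (S n) Hz1).
  set (r := (RtoC (INR (S n)) / (z + 1 + RtoC (INR (S n))))%C).
  assert (E : Cgamma_seq (z + 1) (S n) = (z * r * Cgamma_seq z (S n))%C).
  { unfold Cgamma_seq, r.
    replace ((z + 1) * RtoC (ln (INR (S n))))%C
      with (z * RtoC (ln (INR (S n))) + RtoC (ln (INR (S n))))%C by ring.
    rewrite Cexp_add, Cexp_RtoC, exp_ln by exact HN.
    assert (Cz : z <> 0%C).
    { intros ->; simpl in Hz; lra. }
    assert (Cr := Crising_neq_0 z (S (S n)) Hz).
    assert (Cr1 := Crising_neq_0 (z + 1) (S n) Hz1).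
    rewrite <- (Crising_shift z (S n)) in *.
    change (Crising (z + 1) (S (S n)))
      with (Crising (z + 1) (S n) * (z + 1 + RtoC (INR (S n))))%C.
    field; repeat split; assumption. }
  assert (Hr : Cmod r <= 1).
  { unfold r; rewrite Cmod_div, Cmod_RtoC_pos by (try lra; exact Hnz).
    apply Rle_div_l; lra. }
  assert (Hr1 : Cmod (r - 1) <= Cmod (z + 1) * / INR (S n)).
  { replace (r - 1)%C with (- ((z + 1) / (z + 1 + RtoC (INR (S n)))))%C
      by (unfold r; field; exact Hnz).
    rewrite Cmod_opp, Cmod_div by exact Hnz.
    apply Rmult_le_compat_l; [apply Cmod_ge_0|apply Rinv_le_contravar; lra]. }
  rewrite E.
  replace (z * r * Cgamma_seq z (S n) - z * Cgamma z)%C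
    with (z * (r * (Cgamma_seq z (S n) - Cgamma z) + Cgamma z * (r - 1)))%C by ring.
  rewrite Cmod_mult; apply Rmult_le_compat_l; [exact Mz|].
  eapply Rle_trans; [apply Cmod_triangle|]; rewrite !Cmod_mult.
  apply Rplus_le_compat.
  + rewrite <- (Rmult_1_l (Cmod (Cgamma_seq z (S n) - Cgamma z))) at 2.
    apply Rmult_le_compat_r; [apply Cmod_ge_0|exact Hr].
  + rewrite Rmult_assoc; apply Rmult_le_compat_l; assumption.
- apply is_lim_seq_const.
- replace (Finite 0) with (Finite (Cmod z * (0 + Cmod (Cgamma z) * Cmod (z + 1) * 0)))
    by (f_equal; ring).
  apply (is_lim_seq_scal_l _ (Cmod z) (Finite _)).
  apply is_lim_seq_plus'; [apply (is_lim_seq_incr_1 (fun n => Cmod (Cgamma_seq z n - Cgamma z))); exact L|].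
  apply (is_lim_seq_scal_l _ _ (Finite 0)).
  apply (is_lim_seq_incr_1 (fun n => / INR n)).
  replace (Finite 0) with (Rbar_inv p_infty) by reflexivity.
  apply is_lim_seq_inv; [apply is_lim_seq_INR|discriminate].
Qed.

(** * Lower bound for Gamma *)

Lemma Cmod_add_nat_le (z : C) (k : nat) : Cmod (z + RtoC (INR k)) <= Cmod z + INR k.
Proof.
eapply Rle_trans; [apply Cmod_triangle|].
rewrite Cmod_RtoC_pos by apply pos_INR; apply Rle_refl.
Qed.

(** Each factor satisfies [|z + j| <= J + j], so the product is at most [J (J + 1) ... (J + m) = J *
    (J + m)! / J!]. The statement is this bound cleared of the division. *)
Lemma Crising_le_fact (z : C) (J m : nat) :
  Cmod z <= INR J ->
  Cmod (Crising z (S m)) * INR (fact J) <= INR J * INR (fact (J + m)).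
Proof.
intros Hz; induction m as [|m IH].
- rewrite Nat.add_0_r; apply Rmult_le_compat_r; [apply pos_INR|].
  replace (Crising z 1) with z by (simpl; ring); exact Hz.
- change (Crising z (S (S m))) with (Crising z (S m) * (z + RtoC (INR (S m))))%C.
  rewrite Cmod_mult, Nat.add_succ_r, fact_simpl, mult_INR.
  assert (H := Cmod_add_nat_le z (S m)).
  replace (INR (S (J + m))) with (INR J + INR (S m)) by (rewrite <- plus_INR; f_equal; lia).
  replace (Cmod (Crising z (S m)) * Cmod (z + RtoC (INR (S m))) * INR (fact J))
    with (Cmod (z + RtoC (INR (S m))) * (Cmod (Crising z (S m)) * INR (fact J))) by ring.
  replace (INR J * ((INR J + INR (S m)) * INR (fact (J + m))))
    with ((INR J + INR (S m)) * (INR J * INR (fact (J + m)))) by ring.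
  apply Rmult_le_compat; [apply Cmod_ge_0| |lra|exact IH].
  apply Rmult_le_pos; [apply Cmod_ge_0|apply pos_INR].
Qed.

(** The central binomial coefficient is at most [4 ^ J]: one step multiplies it by
    [(2 J + 2) (2 J + 1) / (J + 1)^2 <= 4]. *)
Lemma fact_double_le (J : nat) : (fact (J + J) <= 4 ^ J * (fact J * fact J))%nat.
Proof.
induction J as [|J IH]; [simpl; lia|].
replace (S J + S J)%nat with (S (S (J + J))) by lia.
rewrite 3!fact_simpl, Nat.pow_succ_r'.
apply Nat.le_trans with (S (S (J + J)) * (S (J + J) * (4 ^ J * (fact J * fact J))))%nat.
- do 2 apply Nat.mul_le_mono_l; exact IH.
- replace (4 * 4 ^ J * (S J * fact J * (S J * fact J)))%nat
    with (4 * S J * S J * (4 ^ J * (fact J * fact J)))%nat by ring.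
  rewrite Nat.mul_assoc; apply Nat.mul_le_mono_r; nia.
Qed.

Lemma Crising_le_pow4 (z : C) (J : nat) :
  Cmod z <= INR J -> Cmod (Crising z (S J)) <= INR (fact J) * (INR J * 4 ^ J).
Proof.
intros Hz.
assert (F := INR_fact_lt_0 J).
apply (Rmult_le_reg_r (INR (fact J))); [exact F|].
eapply Rle_trans; [apply Crising_le_fact, Hz|].
assert (H := le_INR _ _ (fact_double_le J)).
rewrite !mult_INR, pow_INR in H.
replace (INR 4) with 4 in H by (simpl; ring).
replace (INR (fact J) * (INR J * 4 ^ J) * INR (fact J))
  with (INR J * (4 ^ J * (INR (fact J) * INR (fact J)))) by ring.
apply Rmult_le_compat_l; [apply pos_INR|exact H].
Qed.

(** Writing [e] for the exponent, [|1 + z / m|^2] equals [1 + 2 e] exactly, which is at most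
    [exp (2 e)]. *)
Lemma Cmod_add_nat_le_exp (z : C) (m : nat) :
  (1 <= m)%nat ->
  Cmod (z + RtoC (INR m)) <= INR m * exp (fst z / INR m + Cmod z ^ 2 / (2 * INR m ^ 2)).
Proof.
intros Hm.
assert (Hm' : 0 < INR m) by (apply lt_0_INR; lia).
set (e := fst z / INR m + Cmod z ^ 2 / (2 * INR m ^ 2)).
assert (P := exp_pos e).
apply Rsqr_incr_0_var; [|nra].
unfold Rsqr.
replace (Cmod (z + RtoC (INR m)) * Cmod (z + RtoC (INR m)))
  with (Cmod (z + RtoC (INR m)) ^ 2) by ring.
replace (INR m * exp e * (INR m * exp e)) with (INR m ^ 2 * exp (2 * e))
  by (replace (2 * e) with (e + e) by ring; rewrite exp_plus; ring).
apply Rle_trans with (INR m ^ 2 * (1 + 2 * e)).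
- right; unfold e; rewrite !Cmod2_alt; unfold Re, Im; simpl; field; lra.
- apply Rmult_le_compat_l; [apply pow2_ge_0|apply exp_ineq1_le].
Qed.

(** The preceding bound is multiplied over the indices from [J + 1] to [J + k]. In the exponent,
    [1 / j] is at most [ln j - ln (j - 1)], which may be multiplied by [fst z > 0], and [1 / j^2] is
    at most [1 / (j - 1) - 1 / j]; both sums telescope. *)
Lemma Crising_growth (z : C) (J k : nat) :
  0 < fst z -> (1 <= J)%nat ->
  Cmod (Crising z (S (J + k))) * INR (fact J) <=
  Cmod (Crising z (S J)) * INR (fact (J + k)) *
    exp (fst z * (ln (INR (J + k)) - ln (INR J)) +
         Cmod z ^ 2 / 2 * (/ INR J - / INR (J + k))).
Proof.
intros Hz HJ; induction k as [|k IH].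
- rewrite Nat.add_0_r, !Rminus_diag, !Rmult_0_r, Rplus_0_r, exp_0; lra.
- rewrite Nat.add_succ_r; set (n := (J + k)%nat) in *.
  assert (Hn : (1 <= n)%nat) by lia.
  assert (Hn' : 0 < INR n) by (apply lt_0_INR; lia).
  assert (HS : INR (S n) = INR n + 1) by apply S_INR.
  change (Crising z (S (S n))) with (Crising z (S n) * (z + RtoC (INR (S n))))%C.
  rewrite Cmod_mult, fact_simpl, mult_INR.
  assert (H := Cmod_add_nat_le_exp z (S n) ltac:(lia)).
  destruct (ln_succ_bounds n Hn) as [D _].
  assert (E : exp (fst z / INR (S n) + Cmod z ^ 2 / (2 * INR (S n) ^ 2)) <=
     exp (fst z * (ln (INR (S n)) - ln (INR n)) + Cmod z ^ 2 / 2 * (/ INR n - / INR (S n)))).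
  { apply exp_monotone, Rplus_le_compat.
    - apply Rmult_le_compat_l; lra.
    - replace (Cmod z ^ 2 / (2 * INR (S n) ^ 2)) with (Cmod z ^ 2 / 2 * / (INR (S n) ^ 2))
        by (field; lra).
      apply Rmult_le_compat_l; [assert (Q := pow2_ge_0 (Cmod z)); lra|].
      replace (/ INR n - / INR (S n)) with (/ (INR n * INR (S n))) by (rewrite HS; field; lra).
      apply Rinv_le_contravar; nra. }
  replace (fst z * (ln (INR (S n)) - ln (INR J)) + Cmod z ^ 2 / 2 * (/ INR J - / INR (S n)))
    with ((fst z * (ln (INR n) - ln (INR J)) + Cmod z ^ 2 / 2 * (/ INR J - / INR n)) +
          (fst z * (ln (INR (S n)) - ln (INR n)) + Cmod z ^ 2 / 2 * (/ INR n - / INR (S n)))) by ring.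
  rewrite exp_plus.
  set (e1 := exp (fst z * (ln (INR n) - ln (INR J)) + _)) in *.
  set (e2 := exp (fst z * (ln (INR (S n)) - ln (INR n)) + _)) in *.
  replace (Cmod (Crising z (S n)) * Cmod (z + RtoC (INR (S n))) * INR (fact J))
    with ((Cmod (Crising z (S n)) * INR (fact J)) * Cmod (z + RtoC (INR (S n)))) by ring.
  replace (Cmod (Crising z (S J)) * (INR (S n) * INR (fact n)) * (e1 * e2))
    with ((Cmod (Crising z (S J)) * INR (fact n) * e1) * (INR (S n) * e2)) by ring.
  apply Rmult_le_compat; [|apply Cmod_ge_0|exact IH|].
  + apply Rmult_le_pos; [apply Cmod_ge_0|apply pos_INR].
  + eapply Rle_trans; [exact H|apply Rmult_le_compat_l; [apply pos_INR|exact E]].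
Qed.

Lemma INR_mul_pow4_le_exp (J : nat) : INR J * 4 ^ J <= exp (3 * INR J).
Proof.
assert (E1 : 2 <= exp 1) by (assert (H := exp_ineq1_le 1); lra).
assert (E2 : 4 ^ J <= exp (2 * INR J)).
{ replace (2 * INR J) with (INR J * 2) by ring.
  induction J as [|J IH]; [simpl; rewrite Rmult_0_l, exp_0; lra|].
  replace (INR (S J) * 2) with (1 + 1 + INR J * 2) by (rewrite S_INR; ring).
  rewrite !exp_plus; change (4 ^ S J) with (4 * 4 ^ J).
  apply Rmult_le_compat; [lra|apply pow_le; lra|nra|exact IH]. }
assert (E3 := exp_ineq1_le (INR J)).
replace (3 * INR J) with (INR J + 2 * INR J) by ring; rewrite exp_plus.
assert (P := pow_lt 4 J ltac:(lra)).
apply Rmult_le_compat; [apply pos_INR|lra|lra|exact E2].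
Qed.

(** With [n = J + k], the modulus of [n^z] cancels against the growth of the rising factorial and
    leaves [exp (fst z * ln J)]. Of the loss [4 J], the part [3 J] pays for the factors of index at
    most [J], and the rest for the quadratic terms, whose sum is at most [J] because
    [Cmod z <= INR J]. The bound is uniform in [k], hence survives the limit. *)
Lemma Cgamma_seq_ge (z : C) (J k : nat) :
  0 < fst z -> (1 <= J)%nat -> Cmod z <= INR J ->
  exp (fst z * ln (INR J) - 4 * INR J) <= Cmod (Cgamma_seq z (J + k)).
Proof.
intros Hz HJ HzJ.
assert (HJ' : 0 < INR J) by (apply lt_0_INR; lia).
assert (Hn : 0 < INR (J + k)) by (apply lt_0_INR; lia).
assert (G := Crising_growth z J k Hz HJ).
assert (F := INR_fact_lt_0 J); assert (Fn := INR_fact_lt_0 (J + k)).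
assert (A := Rle_trans _ _ _ (Crising_le_pow4 z J HzJ)
  (Rmult_le_compat_l _ _ _ (Rlt_le _ _ F) (INR_mul_pow4_le_exp J))).
set (n := (J + k)%nat) in *.
assert (N0 : Crising z (S n) <> 0%C) by (apply Crising_neq_0, Hz).
unfold Cgamma_seq.
rewrite Cmod_div by exact N0.
rewrite Cmod_mult, Cmod_RtoC_pos, Cmod_Cexp by lra.
apply Cmod_gt_0 in N0.
apply Rle_div_r; [exact N0|].
replace (fst (z * RtoC (ln (INR n)))%C) with (fst z * ln (INR n)) by (simpl; ring).
set (e := exp _) in G at 1.
assert (Ge : e <= exp (fst z * ln (INR n) - fst z * ln (INR J) + INR J)).
{ apply exp_monotone.
  assert (I : 0 < / INR n) by (apply Rinv_0_lt_compat; lra).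
  assert (M := Cmod_ge_0 z).
  assert (Cmod z ^ 2 / 2 * (/ INR J - / INR n) <= INR J).
  { apply Rle_trans with (INR J ^ 2 * / INR J); [|right; field; lra].
    assert (I2 : / INR n <= / INR J)
      by (apply Rinv_le_contravar; [lra|apply le_INR; lia]).
    apply Rmult_le_compat; nra. }
  lra. }
assert (G2 : Cmod (Crising z (S n)) <=
   exp (3 * INR J) * INR (fact n) * exp (fst z * ln (INR n) - fst z * ln (INR J) + INR J)).
{ apply (Rmult_le_reg_r (INR (fact J))); [exact F|].
  eapply Rle_trans; [exact G|].
  replace (exp (3 * INR J) * INR (fact n) *
     exp (fst z * ln (INR n) - fst z * ln (INR J) + INR J) * INR (fact J))
    with ((INR (fact J) * exp (3 * INR J)) * INR (fact n) *
     exp (fst z * ln (INR n) - fst z * ln (INR J) + INR J)) by ring.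
  apply Rmult_le_compat; [|apply Rlt_le, exp_pos| |exact Ge].
  - apply Rmult_le_pos; [apply Cmod_ge_0|lra].
  - apply Rmult_le_compat_r; lra. }
eapply Rle_trans; [apply Rmult_le_compat_l; [apply Rlt_le, exp_pos|exact G2]|].
right.
replace (exp (fst z * ln (INR J) - 4 * INR J) *
   (exp (3 * INR J) * INR (fact n) * exp (fst z * ln (INR n) - fst z * ln (INR J) + INR J)))
  with (INR (fact n) * (exp (fst z * ln (INR J) - 4 * INR J) * exp (3 * INR J) *
    exp (fst z * ln (INR n) - fst z * ln (INR J) + INR J))) by ring.
rewrite <- !exp_plus; do 2 f_equal; ring.
Qed.

Lemma Cgamma_ge (z : C) (J : nat) :
  0 < fst z -> (1 <= J)%nat -> Cmod z <= INR J ->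
  exp (fst z * ln (INR J) - 4 * INR J) <= Cmod (Cgamma z).
Proof.
intros Hz HJ HzJ.
assert (L := is_lim_seq_Cmod _ _ (Cgamma_seq_cv z Hz)).
apply (is_lim_seq_incr_n _ J) in L.
refine (is_lim_seq_le (fun _ => _) _ (Finite _) (Finite _) _ (is_lim_seq_const _) L).
intros n; rewrite Nat.add_comm; apply Cgamma_seq_ge; assumption.
Qed.

Lemma Cgamma_neq_0 (z : C) : 0 < fst z -> Cgamma z <> 0%C.
Proof.
intros Hz; apply Cmod_gt_0.
destruct (INR_unbounded (Cmod z)) as [J HJ].
assert (Hp := Cmod_ge_0 z).
assert (HJ0 : (1 <= J)%nat).
{ destruct J; [simpl in HJ; lra|lia]. }
eapply Rlt_le_trans; [|apply (Cgamma_ge z J Hz HJ0); lra].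
apply exp_pos.
Qed.

(** * Entire power series *)

Lemma CSeries_unique (a : nat -> C) (s : C) :
  is_series (V := C_NormedModule) a s -> CSeries a = s.
Proof.
intros H.
exact (iota_filterlim_locally (V := C_CompleteNormedModule) (sum_n a) s H).
Qed.

Lemma CSeries_ext (a b : nat -> C) : (forall k, a k = b k) -> CSeries a = CSeries b.
Proof.
intros H; f_equal; apply functional_extensionality, H.
Qed.

Lemma is_series_C_ext (a b : nat -> C) (l : C) :
  (forall k, a k = b k) ->
  is_series (V := C_NormedModule) a l -> is_series (V := C_NormedModule) b l.
Proof.
exact (is_series_ext (V := C_NormedModule) a b l).
Qed.

Lemma is_series_C_mult (c : C) (a : nat -> C) (l : C) :
  is_series (V := C_NormedModule) a l ->
  is_series (V := C_NormedModule) (fun k => c * a k)%C (c * l)%C.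
Proof.
exact (is_series_scal (K := C_AbsRing) (V := C_NormedModule) c a l).
Qed.

Lemma is_series_C_plus (a b : nat -> C) (la lb : C) :
  is_series (V := C_NormedModule) a la -> is_series (V := C_NormedModule) b lb ->
  is_series (V := C_NormedModule) (fun k => a k + b k)%C (la + lb)%C.
Proof.
exact (is_series_plus (K := C_AbsRing) (V := C_NormedModule) a b la lb).
Qed.

Lemma is_series_C_minus (a b : nat -> C) (la lb : C) :
  is_series (V := C_NormedModule) a la -> is_series (V := C_NormedModule) b lb ->
  is_series (V := C_NormedModule) (fun k => a k - b k)%C (la - lb)%C.
Proof.
exact (is_series_minus (K := C_AbsRing) (V := C_NormedModule) a b la lb).
Qed.

Lemma Cmod_series_le (a : nat -> C) (b : nat -> R) (l : C) (s : R) :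
  is_series (V := C_NormedModule) a l -> is_series b s ->
  (forall k, Cmod (a k) <= b k) -> Cmod l <= s.
Proof.
intros Ha Hb H.
apply (is_lim_seq_Cmod (sum_n a) l) in Ha.
assert (Hb' : is_lim_seq (sum_n b) s) by exact Hb.
refine (is_lim_seq_le _ _ (Finite _) (Finite _) _ Ha Hb').
intros n.
eapply Rle_trans;
  [apply (norm_sum_n_m (K := C_AbsRing) (V := C_NormedModule) a 0 n)|].
apply sum_n_m_le; exact H.
Qed.

(** Infinite radius of convergence. Boundedness at every radius is easy to check on coefficients and
    already gives absolute summability, since the radius may be doubled. *)
Definition entire_coefs (a : nat -> C) : Prop :=
  forall r : R, 0 < r -> exists c : R, forall k : nat, Cmod (a k) * r ^ k <= c.

Definition Cps (a : nat -> C) (z : C) : C := CSeries (fun k => a k * z ^ k)%C.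

Definition Cps_deriv (a : nat -> C) (k : nat) : C := (RtoC (INR (S k)) * a (S k))%C.

(** Keeping the index [k] of the original power lets the differentiated series be subtracted term by
    term from the difference quotient; [Cps_deriv] is the reindexed version. *)
Definition Cpow_deriv (z : C) (k : nat) : C :=
  match k with O => RtoC 0 | S m => (RtoC (INR (S m)) * z ^ m)%C end.

Lemma INR_le_pow2 (k : nat) : INR k <= 2 ^ k.
Proof.
induction k as [|k IH]; [simpl; lra|].
rewrite S_INR; simpl; assert (H := pow_R1_Rle 2 k ltac:(lra)); lra.
Qed.

(** The bound at radius [2 * r] gives a geometric majorant of ratio 1/2 at radius [r]. *)
Lemma entire_coefs_summable (a : nat -> C) (r : R) :
  entire_coefs a -> 0 < r -> ex_series (fun k => Cmod (a k) * r ^ k).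
Proof.
intros Ha Hr; destruct (Ha (2 * r) ltac:(lra)) as [c Hc].
apply (ex_series_le (K := R_AbsRing) (V := R_CompleteNormedModule)) with
  (b := fun k => c * (/ 2) ^ k).
- intros k; change (Rabs (Cmod (a k) * r ^ k) <= c * (/ 2) ^ k).
  assert (P := pow_lt r k Hr); assert (Q := pow_lt 2 k ltac:(lra)).
  rewrite Rabs_pos_eq by (apply Rmult_le_pos; [apply Cmod_ge_0|lra]).
  specialize (Hc k); rewrite Rpow_mult_distr in Hc.
  rewrite pow_inv; apply (Rmult_le_reg_r (2 ^ k)); [exact Q|].
  replace (c * / 2 ^ k * 2 ^ k) with c by (field; lra); lra.
- apply (ex_series_scal (K := R_AbsRing) (V := R_NormedModule)).
  apply ex_series_geom; rewrite Rabs_pos_eq; lra.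
Qed.

Lemma is_series_Cps (a : nat -> C) (z : C) :
  entire_coefs a -> is_series (V := C_NormedModule) (fun k => a k * z ^ k)%C (Cps a z).
Proof.
intros Ha; assert (Hz := Cmod_ge_0 z).
assert (X : ex_series (V := C_NormedModule) (fun k => a k * z ^ k)%C).
{ apply ex_series_C_le with (fun k => Cmod (a k) * (Cmod z + 1) ^ k).
  - intros k; rewrite Cmod_mult, Cmod_pow.
    apply Rmult_le_compat_l; [apply Cmod_ge_0|apply pow_incr; lra].
  - apply entire_coefs_summable; [exact Ha|lra]. }
destruct X as [s Hs]; unfold Cps; rewrite (CSeries_unique _ _ Hs); exact Hs.
Qed.

(** The factor [k + 1] is absorbed by [2 ^ (k + 1)] through the bound at radius [2 * r]. The shift
    of index costs one power of [r], hence the constant [c / r]. *)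
Lemma entire_coefs_deriv (a : nat -> C) : entire_coefs a -> entire_coefs (Cps_deriv a).
Proof.
intros Ha r Hr; destruct (Ha (2 * r) ltac:(lra)) as [c Hc].
exists (c / r); intros k; unfold Cps_deriv.
rewrite Cmod_mult, Cmod_RtoC_pos by apply pos_INR.
apply (proj1 (Rle_div_r _ _ _ Hr)).
eapply Rle_trans; [|apply (Hc (S k))].
rewrite Rpow_mult_distr.
replace (INR (S k) * Cmod (a (S k)) * r ^ k * r)
  with (Cmod (a (S k)) * (INR (S k) * r ^ S k)) by (simpl; ring).
apply Rmult_le_compat_l; [apply Cmod_ge_0|].
apply Rmult_le_compat_r; [apply pow_le; lra|apply INR_le_pow2].
Qed.

Lemma is_series_Cps_deriv (a : nat -> C) (z : C) :
  entire_coefs a ->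
  is_series (V := C_NormedModule) (fun k => a k * Cpow_deriv z k)%C (Cps (Cps_deriv a) z).
Proof.
intros Ha; apply (is_series_decr_1 (K := C_AbsRing) (V := C_NormedModule)).
change (is_series (V := C_NormedModule) (fun k => a (S k) * Cpow_deriv z (S k))%C
  (Cps (Cps_deriv a) z + - (a O * RtoC 0))%C).
replace (Cps (Cps_deriv a) z + - (a O * 0))%C with (Cps (Cps_deriv a) z) by ring.
apply (is_series_C_ext (fun k => Cps_deriv a k * z ^ k)%C).
- intros k; unfold Cps_deriv, Cpow_deriv; ring.
- apply is_series_Cps, entire_coefs_deriv, Ha.
Qed.

(** The remainders obey [R_(k+1) = (z + h) R_k + h^2 k z^(k-1)]. Induction closes because
    [|z + h| <= M], [k |z|^(k-1) <= (2 M)^k] and [M + 1 <= 2 M]. *)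
Lemma Cmod_Cpow_taylor (z h : C) (M : R) (k : nat) :
  1 <= M -> Cmod z + Cmod h <= M ->
  Cmod ((z + h) ^ k - z ^ k - h * Cpow_deriv z k)%C <= Cmod h ^ 2 * (2 * M) ^ k.
Proof.
intros HM1 HM; assert (Hz := Cmod_ge_0 z); assert (Hh := Cmod_ge_0 h).
assert (Hh2 := pow2_ge_0 (Cmod h)).
induction k as [|k IH].
- simpl; replace (1 - 1 - h * 0)%C with (RtoC 0) by ring; rewrite Cmod_0; nra.
- replace ((z + h) ^ S k - z ^ S k - h * Cpow_deriv z (S k))%C
    with ((z + h) * ((z + h) ^ k - z ^ k - h * Cpow_deriv z k) + h * h * Cpow_deriv z k)%C.
  2:{ destruct k as [|k]; unfold Cpow_deriv; rewrite ?S_INR, ?RtoC_plus; simpl; ring. }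
  eapply Rle_trans; [apply Cmod_triangle|].
  assert (B : Cmod (Cpow_deriv z k) <= 2 ^ k * M ^ k).
  { destruct k as [|k]; unfold Cpow_deriv; [rewrite Cmod_0; simpl; lra|].
    rewrite Cmod_mult, Cmod_RtoC_pos, Cmod_pow by apply pos_INR.
    apply Rmult_le_compat; [apply pos_INR|apply pow_le, Hz|apply INR_le_pow2|].
    apply Rle_trans with (M ^ k); [apply pow_incr; lra|].
    apply Rle_pow; [exact HM1|lia]. }
  rewrite !Cmod_mult.
  assert (A : Cmod (z + h) <= M) by (eapply Rle_trans; [apply Cmod_triangle|exact HM]).
  assert (P : 0 <= (2 * M) ^ k) by (apply pow_le; lra).
  rewrite <- Rpow_mult_distr in B.
  apply Rle_trans with (M * (Cmod h ^ 2 * (2 * M) ^ k) + Cmod h ^ 2 * (2 * M) ^ k).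
  + apply Rplus_le_compat.
    * apply Rmult_le_compat; try apply Cmod_ge_0; assumption.
    * replace (Cmod h * Cmod h) with (Cmod h ^ 2) by ring.
      apply Rmult_le_compat_l; assumption.
  + replace (Cmod h ^ 2 * (2 * M) ^ S k) with (2 * M * (Cmod h ^ 2 * (2 * M) ^ k))
      by (simpl; ring).
    assert (0 <= Cmod h ^ 2 * (2 * M) ^ k) by (apply Rmult_le_pos; assumption); nra.
Qed.

(** The Taylor bound with [M = Cmod z + 1], valid for [|h| < 1], is summed against the coefficients.
    The quadratic constant is the sum of [|a_k| (2 M)^k]. *)
Lemma is_derive_Cps (a : nat -> C) (z : C) :
  entire_coefs a -> is_derive (Cps a) z (Cps (Cps_deriv a) z).
Proof.
intros Ha; assert (Hz := Cmod_ge_0 z).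
destruct (entire_coefs_summable a (2 * (Cmod z + 1)) Ha ltac:(lra)) as [s Hs].
assert (Hs0 : 0 <= s).
{ apply Rle_trans with (1 := Cmod_ge_0 (Cps a z)).
  apply (Cmod_series_le _ _ _ _ (is_series_Cps a z Ha) Hs).
  intros k; rewrite Cmod_mult, Cmod_pow.
  apply Rmult_le_compat_l; [apply Cmod_ge_0|apply pow_incr; lra]. }
apply is_derive_C_quadratic with (r := 1) (c := s); [lra|exact Hs0|].
intros h Hh.
apply (Cmod_series_le
  (fun k => a k * ((z + h) ^ k - z ^ k - h * Cpow_deriv z k))%C
  (fun k => Cmod h ^ 2 * (Cmod (a k) * (2 * (Cmod z + 1)) ^ k))).
- apply (is_series_C_ext
    (fun k => a k * (z + h) ^ k - a k * z ^ k - h * (a k * Cpow_deriv z k))%C).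
  + intros k; ring.
  + apply is_series_C_minus; [apply is_series_C_minus; apply is_series_Cps, Ha|].
    apply is_series_C_mult, is_series_Cps_deriv, Ha.
- rewrite (Rmult_comm s); exact (is_series_scal (K := R_AbsRing) (V := R_NormedModule) _ _ _ Hs).
- intros k; rewrite Cmod_mult.
  assert (T := Cmod_Cpow_taylor z h (Cmod z + 1) k ltac:(lra) ltac:(lra)).
  rewrite (Rmult_comm (Cmod h ^ 2)), Rmult_assoc.
  apply Rmult_le_compat_l; [apply Cmod_ge_0|lra].
Qed.

Lemma Cps_ext (a b : nat -> C) (z : C) : (forall k, a k = b k) -> Cps a z = Cps b z.
Proof.
intros H; apply CSeries_ext; intros k; rewrite H; reflexivity.
Qed.

Lemma Cps_scal (c : C) (a : nat -> C) (z : C) :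
  entire_coefs a -> Cps (fun k => c * a k)%C z = (c * Cps a z)%C.
Proof.
intros Ha; apply CSeries_unique.
apply (is_series_C_ext (fun k => c * (a k * z ^ k))%C).
- intros k; ring.
- apply is_series_C_mult, is_series_Cps, Ha.
Qed.

(** The operator [c z d/dz + d] multiplies the coefficient of index [k] by [c k + d]. Identity (ii)
    takes [c = 1], and (iii) takes [c = s] with constant term [t - 1]. *)
Lemma Cps_euler (c d : C) (a : nat -> C) (z : C) :
  entire_coefs a ->
  Cps (fun k => (c * RtoC (INR k) + d) * a k)%C z =
  (c * (z * Cps (Cps_deriv a) z) + d * Cps a z)%C.
Proof.
intros Ha; apply CSeries_unique.
apply (is_series_C_ext
  (fun k => c * (z * (a k * Cpow_deriv z k)) + d * (a k * z ^ k))%C).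
- intros k; destruct k as [|k]; unfold Cpow_deriv; simpl; ring.
- apply is_series_C_plus; apply is_series_C_mult; [apply is_series_C_mult|].
  + apply is_series_Cps_deriv, Ha.
  + apply is_series_Cps, Ha.
Qed.

(** * The complex Prabhakar function *)

Definition prab_coef (d s t : C) (k : nat) : C :=
  (Crising d k / (RtoC (INR (fact k)) * Cgamma (s * RtoC (INR k) + t)))%C.

Definition Cprabhakar (d s t : C) : C -> C := Cps (prab_coef d s t).

(** Each factor satisfies [|d + j| <= (j + 1) (1 + |d|)]. The factorial produced cancels the one in
    the denominator of the Prabhakar coefficient. *)
Lemma Cmod_Crising_le (d : C) (k : nat) :
  Cmod (Crising d k) <= INR (fact k) * (1 + Cmod d) ^ k.
Proof.
assert (Hd := Cmod_ge_0 d).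
induction k as [|k IH]; [simpl; rewrite Cmod_1; lra|].
change (Crising d (S k)) with (Crising d k * (d + RtoC (INR k)))%C.
rewrite Cmod_mult, fact_simpl, mult_INR, S_INR.
replace ((INR k + 1) * INR (fact k) * (1 + Cmod d) ^ S k)
  with (INR (fact k) * (1 + Cmod d) ^ k * ((INR k + 1) * (1 + Cmod d))) by (simpl; ring).
apply Rmult_le_compat; try apply Cmod_ge_0; [exact IH|].
eapply Rle_trans; [apply Cmod_add_nat_le|].
assert (Hk := pos_INR k); nra.
Qed.

Lemma RtoC_fact_neq_0 (k : nat) : RtoC (INR (fact k)) <> 0%C.
Proof.
intros E; apply RtoC_inj in E; exact (INR_fact_neq_0 k E).
Qed.

Lemma fst_affine_pos (s t : C) (k : nat) :
  0 < fst s -> 0 < fst t -> 0 < fst (s * RtoC (INR k) + t)%C.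
Proof.
intros Hs Ht; simpl; assert (Hk := pos_INR k); nra.
Qed.

(** The lower bound for Gamma is used with [J = K * (k + 1)], which dominates [|s k + t|]; then
    [ln J >= ln (k + 1)]. *)
Lemma Cgamma_affine_ge (s t : C) (K k : nat) :
  0 < fst s -> 0 < fst t -> (1 <= K)%nat -> Cmod s <= INR K -> Cmod t <= INR K ->
  exp (fst s * INR k * ln (INR k + 1) - 4 * INR K * (INR k + 1)) <=
  Cmod (Cgamma (s * RtoC (INR k) + t)).
Proof.
intros Hs Ht HK HsK HtK.
assert (Hk := pos_INR k).
assert (HK1 : 1 <= INR K) by (apply (le_INR 1), HK).
assert (HJ : INR (K * S k) = INR K * (INR k + 1)) by (rewrite mult_INR, S_INR; ring).
eapply Rle_trans; [|apply (Cgamma_ge _ (K * S k))].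
- apply exp_monotone; rewrite HJ.
  replace (fst (s * RtoC (INR k) + t)%C) with (fst s * INR k + fst t) by (simpl; ring).
  assert (L0 : 0 <= ln (INR k + 1)).
  { rewrite <- ln_1; apply ln_le; lra. }
  assert (L1 : ln (INR k + 1) <= ln (INR K * (INR k + 1))) by (apply ln_le; nra).
  assert (fst s * INR k * ln (INR k + 1) <=
    (fst s * INR k + fst t) * ln (INR K * (INR k + 1))); [|lra].
  apply Rmult_le_compat; try nra.
- apply fst_affine_pos; assumption.
- nia.
- rewrite HJ.
  eapply Rle_trans; [apply Cmod_triangle|].
  rewrite Cmod_mult, Cmod_RtoC_pos by exact Hk; nra.
Qed.

(** After cancelling [k!], the term at radius [r] is at most
    [exp (4 K + k (L - fst s * ln (k + 1)))]. The logarithm eventually outweighs the constant [L],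
    so the exponent is bounded above. *)
Lemma entire_prab_coef (d s t : C) :
  0 < fst s -> 0 < fst t -> entire_coefs (prab_coef d s t).
Proof.
intros Hs Ht r Hr.
assert (Md := Cmod_ge_0 d); assert (Ms := Cmod_ge_0 s); assert (Mt := Cmod_ge_0 t).
destruct (INR_unbounded (1 + Cmod s + Cmod t)) as [K HK].
assert (HK1 : (1 <= K)%nat) by (apply INR_le; simpl; lra).
set (L := ln ((1 + Cmod d) * r) + 4 * INR K).
(* From [k0] on, [fst s * ln (k + 1)] is at least [Rabs L], so the exponent is at most [4 K]; for
   smaller [k] it is at most [4 K + k0 |L|]. *)
destruct (INR_unbounded (exp (Rabs L / fst s))) as [k0 Hk0].
exists (exp (4 * INR K + INR k0 * Rabs L)); intros k.
assert (Hk := pos_INR k); assert (HL := Rabs_pos L); assert (HL' := Rle_abs L).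
assert (G := Cgamma_affine_ge s t K k Hs Ht HK1 ltac:(lra) ltac:(lra)).
assert (Fk := INR_fact_lt_0 k).
assert (R := Cmod_Crising_le d k).
assert (N := Cgamma_neq_0 _ (fst_affine_pos s t k Hs Ht)).
unfold prab_coef.
rewrite Cmod_div by (apply Cmult_neq_0; [apply RtoC_fact_neq_0|exact N]).
rewrite Cmod_mult, Cmod_RtoC_pos by lra.
apply Cmod_gt_0 in N.
set (g := Cmod (Cgamma _)) in *; set (e := _ - _) in G.
replace (Cmod (Crising d k) / (INR (fact k) * g) * r ^ k)
  with ((Cmod (Crising d k) * r ^ k) / (INR (fact k) * g)) by (field; lra).
apply Rle_div_l; [nra|].
apply Rle_trans with (INR (fact k) * (1 + Cmod d) ^ k * r ^ k).
{ apply Rmult_le_compat_r; [apply pow_le; lra|exact R]. }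
apply Rle_trans with (exp (4 * INR K + INR k0 * Rabs L) * (INR (fact k) * exp e)).
2:{ apply Rmult_le_compat_l; [apply Rlt_le, exp_pos|].
    apply Rmult_le_compat_l; lra. }
replace (INR (fact k) * (1 + Cmod d) ^ k * r ^ k)
  with (INR (fact k) * exp (INR k * ln ((1 + Cmod d) * r))).
2:{ rewrite Rmult_assoc, <- Rpow_mult_distr; f_equal.
    rewrite <- Rpower_pow by nra; reflexivity. }
replace (exp (4 * INR K + INR k0 * Rabs L) * (INR (fact k) * exp e))
  with (INR (fact k) * exp (4 * INR K + INR k0 * Rabs L + e)) by (rewrite exp_plus; ring).
apply Rmult_le_compat_l; [lra|]; apply exp_monotone.
unfold e.
cut (INR k * (L - fst s * ln (INR k + 1)) <= INR k0 * Rabs L); [unfold L; lra|].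
destruct (Rle_dec (INR k0) (INR k)) as [Hkk|Hkk].
- assert (Rabs L / fst s <= ln (INR k + 1)).
  { rewrite <- (ln_exp (Rabs L / fst s)); apply ln_le; [apply exp_pos|lra]. }
  assert (Rabs L <= fst s * ln (INR k + 1)).
  { apply (Rmult_le_compat_l (fst s)) in H; [|lra].
    replace (fst s * (Rabs L / fst s)) with (Rabs L) in H by (field; lra); exact H. }
  assert (Hk0' := pos_INR k0); nra.
- assert (0 <= ln (INR k + 1)).
  { rewrite <- ln_1; apply ln_le; lra. }
  assert (0 <= INR k * (fst s * ln (INR k + 1))) by (apply Rmult_le_pos; nra).
  nra.
Qed.

(** Three shifts combine: [(k + 1) / (k + 1)! = 1 / k!], [(d)_(k+1) = d (d + 1)_k], and
    [s (k + 1) + t = s k + (t + s)]. *)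
Lemma Cps_deriv_prab_coef (d s t : C) (k : nat) :
  0 < fst s -> 0 < fst t ->
  Cps_deriv (prab_coef d s t) k = (d * prab_coef (d + 1) s (t + s) k)%C.
Proof.
intros Hs Ht; unfold Cps_deriv, prab_coef.
rewrite <- (Crising_shift d k), fact_simpl, mult_INR, RtoC_mult.
replace (s * RtoC (INR (S k)) + t)%C with (s * RtoC (INR k) + (t + s))%C
  by (rewrite S_INR, RtoC_plus; ring).
assert (N : Cgamma (s * RtoC (INR k) + (t + s)) <> 0%C).
{ apply Cgamma_neq_0, fst_affine_pos; simpl; lra. }
field; repeat split; [exact N|apply RtoC_fact_neq_0|].
intros E; apply RtoC_inj in E; revert E; apply not_0_INR; lia.
Qed.

Lemma is_derive_Cprabhakar (d s t z : C) :
  0 < fst s -> 0 < fst t ->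
  is_derive (Cprabhakar d s t) z (d * Cprabhakar (d + 1) s (t + s) z)%C.
Proof.
intros Hs Ht; unfold Cprabhakar.
rewrite <- Cps_scal by (apply entire_prab_coef; simpl; lra).
rewrite <- (Cps_ext _ _ _ (fun k => Cps_deriv_prab_coef d s t k Hs Ht)).
apply is_derive_Cps, entire_prab_coef; assumption.
Qed.

(** Identity (ii) in one component, with the derivative already replaced by its closed form. On
    coefficients it reads [(k + d) (d)_k = d (d + 1)_k]. *)
Lemma Cprabhakar_euler (d s t z : C) :
  0 < fst s -> 0 < fst t ->
  (z * (d * Cprabhakar (d + 1) s (t + s) z) + d * Cprabhakar d s t z)%C =
  (d * Cprabhakar (d + 1) s t z)%C.
Proof.
intros Hs Ht; unfold Cprabhakar.
rewrite <- (Cps_scal d (prab_coef (d + 1) s (t + s))),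
  <- (Cps_scal d (prab_coef (d + 1) s t)) by (apply entire_prab_coef; simpl; lra).
rewrite <- (Cps_ext _ _ _ (fun k => Cps_deriv_prab_coef d s t k Hs Ht)).
assert (E := Cps_euler 1 d _ z (entire_prab_coef d s t Hs Ht)).
rewrite Cmult_1_l in E; rewrite <- E.
apply Cps_ext; intros k; unfold prab_coef, Cdiv.
rewrite !Cmult_assoc, Crising_shift; simpl; ring.
Qed.

(** The left side multiplies the coefficients by [w = s k + t - 1], and
    [w / Gamma(w + 1) = 1 / Gamma(w)]. The bound [1 < fst t] keeps [w] in the right half-plane,
    where the functional equation is available. *)
Lemma Cprabhakar_lower_second (d s t z : C) :
  0 < fst s -> 1 < fst t ->
  (s * (z * (d * Cprabhakar (d + 1) s (t + s) z)) + (t - 1) * Cprabhakar d s t z)%C =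
  Cprabhakar d s (t - 1) z.
Proof.
intros Hs Ht; assert (Ht0 : 0 < fst t) by lra; unfold Cprabhakar.
rewrite <- (Cps_scal d) by (apply entire_prab_coef; simpl; lra).
rewrite <- (Cps_ext _ _ _ (fun k => Cps_deriv_prab_coef d s t k Hs Ht0)).
rewrite <- Cps_euler by (apply entire_prab_coef; assumption).
apply Cps_ext; intros k; unfold prab_coef.
set (w := (s * RtoC (INR k) + (t - 1))%C).
assert (Hw : 0 < fst w) by (apply fst_affine_pos; simpl; lra).
replace (s * RtoC (INR k) + t)%C with (w + 1)%C by (unfold w; ring).
rewrite Cgamma_succ by exact Hw.
assert (Nw : w <> 0%C) by (intros E; rewrite E in Hw; simpl in Hw; lra).
field; repeat split;
  [apply Cgamma_neq_0, Hw|apply RtoC_fact_neq_0|exact Nw].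
Qed.

(** * Powers through a branch of the logarithm *)

(** Differentiating [Cexp (L x) = x] by the chain rule and comparing with the derivative of the
    identity gives [m * Cexp (L z) = 1]. *)
Lemma is_derive_log (L : C -> C) (z : C) :
  locally (z : C_UniformSpace) (fun x : C => Cexp (L x) = x) -> ex_derive L z ->
  exists m : C, is_derive L z m /\ (m * z)%C = 1%C.
Proof.
intros HL [m Hm]; exists m; split; [exact Hm|].
assert (Hz : Cexp (L z) = z) by exact (locally_singleton _ _ HL).
rewrite <- Hz at 1.
apply (is_derive_C_unique (fun x => x) z).
- apply (is_derive_ext_loc (K := C_AbsRing) (V := C_NormedModule) (fun x : C => Cexp (L x))).
  + apply locally_C; exact HL.
  + exact (is_derive_C_comp Cexp L z _ _ (is_derive_Cexp (L z)) Hm).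
- apply is_derive_C_AbsRing; exact (is_derive_id (K := C_AbsRing) z).
Qed.

(** One step of (iii). The product and chain rules give [m z^(t-1)] times [(t - 1) E + s l z^s E'],
    where [m] is the derivative of the logarithm. The second factor is the function with [t] lowered
    by 1. *)
Lemma is_derive_Cpow_Cprabhakar (L : C -> C) (l d s t e z : C) :
  locally (z : C_UniformSpace) (fun x : C => Cexp (L x) = x) -> ex_derive L z ->
  0 < fst s -> 1 < fst t -> e = (t - 1)%C ->
  is_derive (fun x => Cexp (e * L x) * Cprabhakar d s t (l * Cexp (s * L x)))%C z
    (Cexp ((e - 1) * L z) * Cprabhakar d s (t - 1) (l * Cexp (s * L z)))%C.
Proof.
intros HL EL Hs Ht ->.
destruct (is_derive_log L z HL EL) as [m [Hm Hmz]].
assert (Hz : Cexp (L z) = z) by exact (locally_singleton _ _ HL).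
assert (P : forall c : C, is_derive (fun x => Cexp (c * L x)) z (c * m * Cexp (c * L z))%C).
{ intros c; apply (is_derive_C_comp Cexp (fun x => c * L x)%C);
    [apply is_derive_Cexp|apply is_derive_C_const_mult, Hm]. }
assert (E := is_derive_C_comp (Cprabhakar d s t) (fun x => l * Cexp (s * L x))%C z _ _
  (is_derive_Cprabhakar d s t _ Hs ltac:(lra)) (is_derive_C_const_mult l _ z _ (P s))).
assert (D := is_derive_C_mult _ _ z _ _ (P (t - 1)%C) E).
rewrite <- Cprabhakar_lower_second by assumption.
(* As [m * z = 1], multiplying by [m] lowers the exponent of the power by one. *)
replace (Cexp ((t - 1 - 1) * L z)) with (m * Cexp ((t - 1) * L z))%C.
2:{ replace ((t - 1) * L z)%C with ((t - 1 - 1) * L z + L z)%C by ring.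
    rewrite Cexp_add, Hz, (Cmult_comm _ z), Cmult_assoc, Hmz; ring. }
match goal with |- is_derive _ _ ?y => match type of D with is_derive _ _ ?x =>
  replace y with x; [exact D|ring] end end.
Qed.

(** * Bicomplex functions *)

Lemma bicomplex_ext (x y : bicomplex) : comp1 x = comp1 y -> comp2 x = comp2 y -> x = y.
Proof.
intros H1 H2; rewrite <- (idem_comp x), <- (idem_comp y), H1, H2; reflexivity.
Qed.

Lemma comp1_add (x y : bicomplex) : comp1 (x + y)%B = (comp1 x + comp1 y)%C.
Proof. unfold comp1, badd; simpl; ring. Qed.

Lemma comp2_add (x y : bicomplex) : comp2 (x + y)%B = (comp2 x + comp2 y)%C.
Proof. unfold comp2, badd; simpl; ring. Qed.

Lemma comp1_sub (x y : bicomplex) : comp1 (x - y)%B = (comp1 x - comp1 y)%C.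
Proof. unfold comp1, bsub, badd, bopp; simpl; ring. Qed.

Lemma comp2_sub (x y : bicomplex) : comp2 (x - y)%B = (comp2 x - comp2 y)%C.
Proof. unfold comp2, bsub, badd, bopp; simpl; ring. Qed.

Lemma comp1_bnat (n : nat) : comp1 (bnat n) = RtoC (INR n).
Proof. unfold comp1, bnat, bC; simpl; ring. Qed.

Lemma comp2_bnat (n : nat) : comp2 (bnat n) = RtoC (INR n).
Proof. unfold comp2, bnat, bC; simpl; ring. Qed.

Lemma comp1_div (x y : bicomplex) : comp1 (x / y)%B = (comp1 x / comp1 y)%C.
Proof. unfold bdiv, binv; rewrite comp1_mul, comp1_idem; reflexivity. Qed.

Lemma comp2_div (x y : bicomplex) : comp2 (x / y)%B = (comp2 x / comp2 y)%C.
Proof. unfold bdiv, binv; rewrite comp2_mul, comp2_idem; reflexivity. Qed.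

Lemma comp1_bpown (x : bicomplex) (k : nat) : comp1 (bpown x k) = (comp1 x ^ k)%C.
Proof.
induction k as [|k IH]; [apply (comp1_bnat 1)|simpl; rewrite comp1_mul, IH; reflexivity].
Qed.

Lemma comp2_bpown (x : bicomplex) (k : nat) : comp2 (bpown x k) = (comp2 x ^ k)%C.
Proof.
induction k as [|k IH]; [apply (comp2_bnat 1)|simpl; rewrite comp2_mul, IH; reflexivity].
Qed.

Lemma comp1_bpoch (d : bicomplex) (k : nat) : comp1 (bpoch d k) = Crising (comp1 d) k.
Proof.
induction k as [|k IH]; [apply (comp1_bnat 1)|].
simpl; rewrite comp1_mul, comp1_add, comp1_bnat, IH; reflexivity.
Qed.

Lemma comp2_bpoch (d : bicomplex) (k : nat) : comp2 (bpoch d k) = Crising (comp2 d) k.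
Proof.
induction k as [|k IH]; [apply (comp2_bnat 1)|].
simpl; rewrite comp2_mul, comp2_add, comp2_bnat, IH; reflexivity.
Qed.

Lemma comp1_prabhakar (d s t z : bicomplex) :
  comp1 (prabhakar d s t z) = Cprabhakar (comp1 d) (comp1 s) (comp1 t) (comp1 z).
Proof.
unfold prabhakar, bSeries; rewrite comp1_idem; apply CSeries_ext; intros k.
unfold bgamma.
rewrite comp1_mul, comp1_div, comp1_mul, comp1_idem, comp1_add, comp1_mul,
  !comp1_bnat, comp1_bpown, comp1_bpoch; reflexivity.
Qed.

Lemma comp2_prabhakar (d s t z : bicomplex) :
  comp2 (prabhakar d s t z) = Cprabhakar (comp2 d) (comp2 s) (comp2 t) (comp2 z).
Proof.
unfold prabhakar, bSeries; rewrite comp2_idem; apply CSeries_ext; intros k.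
unfold bgamma.
rewrite comp2_mul, comp2_div, comp2_mul, comp2_idem, comp2_add, comp2_mul,
  !comp2_bnat, comp2_bpown, comp2_bpoch; reflexivity.
Qed.

Lemma fst_comp1 (x : bicomplex) : fst (comp1 x) = bRe x + bIm_j x.
Proof. unfold comp1, bRe, bIm_j; simpl; ring. Qed.

Lemma fst_comp2 (x : bicomplex) : fst (comp2 x) = bRe x - bIm_j x.
Proof. unfold comp2, bRe, bIm_j; simpl; ring. Qed.

(** The real parts of the two components are [bRe x + bIm_j x] and [bRe x - bIm_j x], so the
    bicomplex conditions become half-plane conditions. *)
Lemma comp_re_gt (x : bicomplex) (c : R) :
  Rabs (bIm_j x) < bRe x - c -> c < fst (comp1 x) /\ c < fst (comp2 x).
Proof.
intros H; apply Rabs_lt_between in H; rewrite fst_comp1, fst_comp2; lra.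
Qed.

Lemma locally_comp (z : bicomplex) (P1 P2 : C -> Prop) :
  locally (comp1 z : C_UniformSpace) P1 -> locally (comp2 z : C_UniformSpace) P2 ->
  locally (z : prod_UniformSpace C_UniformSpace C_UniformSpace)
    (fun x : bicomplex => P1 (comp1 x) /\ P2 (comp2 x)).
Proof.
intros [e1 H1] [e2 H2].
assert (E1 := cond_pos e1); assert (E2 := cond_pos e2).
(* Every coordinate of a component is a sum or difference of two coordinates of the bicomplex
   number, which costs a factor 2 in the radius. *)
assert (He : 0 < Rmin e1 e2 / 2) by (assert (E := Rmin_pos _ _ E1 E2); lra).
exists (mkposreal _ He).
assert (M1 := Rmin_l e1 e2); assert (M2 := Rmin_r e1 e2).
destruct z as [[z1 z2] [z3 z4]]; intros [[x1 x2] [x3 x4]] [[B1 B2] [B3 B4]].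
change (Rabs (x1 - z1) < Rmin e1 e2 / 2) in B1.
change (Rabs (x2 - z2) < Rmin e1 e2 / 2) in B2.
change (Rabs (x3 - z3) < Rmin e1 e2 / 2) in B3.
change (Rabs (x4 - z4) < Rmin e1 e2 / 2) in B4.
apply Rabs_lt_between in B1, B2, B3, B4.
split; [apply H1|apply H2]; split; apply Rabs_lt_between;
  unfold minus, plus, opp; simpl; lra.
Qed.

(** * Bicomplex derivatives *)

(** Reduces a bicomplex derivative to two complex ones. Openness of [U1] and [U2] supplies the
    holomorphy near the components that [is_bderive] demands. *)
Lemma is_bderive_componentwise (U1 U2 : C -> Prop) (f1 f2 g1 g2 : C -> C)
    (f : bicomplex -> bicomplex) (z l : bicomplex) :
  open (U1 : C_UniformSpace -> Prop) -> open (U2 : C_UniformSpace -> Prop) ->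
  U1 (comp1 z) -> U2 (comp2 z) ->
  (forall w, U1 w -> is_derive f1 w (g1 w)) ->
  (forall w, U2 w -> is_derive f2 w (g2 w)) ->
  (forall x, comp1 (f x) = f1 (comp1 x)) -> (forall x, comp2 (f x) = f2 (comp2 x)) ->
  comp1 l = g1 (comp1 z) -> comp2 l = g2 (comp2 z) ->
  is_bderive f z l.
Proof.
intros O1 O2 H1 H2 D1 D2 F1 F2 E1 E2; exists f1, f2; repeat split.
- exists (mkposreal 1 Rlt_0_1); intros x _.
  apply bicomplex_ext; rewrite ?comp1_idem, ?comp2_idem; auto.
- apply filter_imp with (2 := O1 _ H1); intros w Hw; exists (g1 w); auto.
- apply filter_imp with (2 := O2 _ H2); intros w Hw; exists (g2 w); auto.
- exists (g1 (comp1 z)), (g2 (comp2 z)); repeat split; try (apply D1; exact H1);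
    try (apply D2; exact H2).
  apply bicomplex_ext; rewrite ?comp1_idem, ?comp2_idem; auto.
Qed.

Ltac bcomp :=
  repeat first
    [ rewrite comp1_add | rewrite comp2_add | rewrite comp1_sub | rewrite comp2_sub
    | rewrite comp1_mul | rewrite comp2_mul | rewrite comp1_bnat | rewrite comp2_bnat
    | rewrite comp1_bpoch | rewrite comp2_bpoch
    | rewrite comp1_prabhakar | rewrite comp2_prabhakar
    | rewrite comp1_idem | rewrite comp2_idem ].

(** The constant [c] carries the factor [(d)_m] accumulated by repeated differentiation. *)
Lemma is_bderive_prabhakar_scal (c d s t z : bicomplex) :
  Rabs (bIm_j t) < bRe t -> Rabs (bIm_j s) < bRe s ->
  is_bderive (fun x => c * prabhakar d s t x)%B z
    (c * (d * prabhakar (d + bnat 1) s (t + s) z))%B.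
Proof.
intros Ht Hs.
destruct (comp_re_gt t 0 ltac:(lra)) as [T1 T2].
destruct (comp_re_gt s 0 ltac:(lra)) as [S1 S2].
apply is_bderive_componentwise with (U1 := fun _ => True) (U2 := fun _ => True)
  (f1 := fun w => (comp1 c * Cprabhakar (comp1 d) (comp1 s) (comp1 t) w)%C)
  (f2 := fun w => (comp2 c * Cprabhakar (comp2 d) (comp2 s) (comp2 t) w)%C)
  (g1 := fun w => (comp1 c * (comp1 d *
            Cprabhakar (comp1 d + 1) (comp1 s) (comp1 t + comp1 s) w))%C)
  (g2 := fun w => (comp2 c * (comp2 d *
            Cprabhakar (comp2 d + 1) (comp2 s) (comp2 t + comp2 s) w))%C);
  try exact I; try exact open_true; intros; bcomp; try reflexivity;
  apply is_derive_C_const_mult, is_derive_Cprabhakar; assumption.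
Qed.

(** The admissible parameters form a convex cone, so those reached by repeated differentiation
    remain admissible. *)
Lemma bRe_bIm_affine (s t : bicomplex) (m : nat) :
  Rabs (bIm_j t) < bRe t -> Rabs (bIm_j s) < bRe s ->
  Rabs (bIm_j (t + bnat m * s)%B) < bRe (t + bnat m * s)%B.
Proof.
intros Ht Hs; assert (Hm := pos_INR m).
replace (bIm_j (t + bnat m * s)%B) with (bIm_j t + INR m * bIm_j s)
  by (unfold bIm_j; simpl; ring).
replace (bRe (t + bnat m * s)%B) with (bRe t + INR m * bRe s)
  by (unfold bRe; simpl; ring).
apply Rabs_lt_between in Ht, Hs; apply Rabs_lt_between; nra.
Qed.

Lemma is_bderive_n_prabhakar (d s t : bicomplex) (m : nat) (z : bicomplex) :
  Rabs (bIm_j t) < bRe t -> Rabs (bIm_j s) < bRe s ->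
  is_bderive_n m (prabhakar d s t) z
    (bpoch d m * prabhakar (d + bnat m) s (t + bnat m * s) z)%B.
Proof.
intros Ht Hs; revert z; induction m as [|m IH]; intros z.
- apply bicomplex_ext; bcomp; simpl; rewrite ?Cmult_1_l, ?Cmult_0_l, ?Cplus_0_r; reflexivity.
- exists (fun x => bpoch d m * prabhakar (d + bnat m) s (t + bnat m * s) x)%B; split.
  + exists (mkposreal 1 Rlt_0_1); intros x _; apply IH.
  + replace (bpoch d (S m) * prabhakar (d + bnat (S m)) s (t + bnat (S m) * s) z)%B
      with (bpoch d m * ((d + bnat m) *
        prabhakar (d + bnat m + bnat 1) s (t + bnat m * s + s) z))%B.
    * apply is_bderive_prabhakar_scal; [apply bRe_bIm_affine; assumption|exact Hs].
    * assert (A : forall a : C, (a + RtoC (INR m) + RtoC (INR 1))%C = (a + RtoC (INR (S m)))%C)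
        by (intros; rewrite (S_INR m), RtoC_plus; simpl; ring).
      assert (B : forall a b : C,
          (a + RtoC (INR m) * b + b)%C = (a + RtoC (INR (S m)) * b)%C)
        by (intros; rewrite S_INR, RtoC_plus; ring).
      apply bicomplex_ext; bcomp; rewrite A, B; apply Cmult_assoc.
Qed.

Lemma is_bderive_n_bpow_prabhakar (d s t l : bicomplex) (U1 U2 : C -> Prop)
    (L1 L2 : C -> C) (m : nat) (z : bicomplex) :
  log_branch U1 L1 -> log_branch U2 L2 ->
  Rabs (bIm_j s) < bRe s -> Rabs (bIm_j t) < bRe t - INR m ->
  U1 (comp1 z) -> U2 (comp2 z) ->
  is_bderive_n m
    (fun x : bicomplex => (bpow L1 L2 x (t - bnat 1) *
                           prabhakar d s t (l * bpow L1 L2 x s))%B) z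
    (bpow L1 L2 z (t - bnat m - bnat 1) *
       prabhakar d s (t - bnat m) (l * bpow L1 L2 z s))%B.
Proof.
intros [O1 B1] [O2 B2] Hs.
assert (HL1 : forall w, U1 w ->
  locally (w : C_UniformSpace) (fun x : C => Cexp (L1 x) = x)).
{ intros w Hw; apply filter_imp with (2 := O1 w Hw); intros x Hx; apply B1, Hx. }
assert (HL2 : forall w, U2 w ->
  locally (w : C_UniformSpace) (fun x : C => Cexp (L2 x) = x)).
{ intros w Hw; apply filter_imp with (2 := O2 w Hw); intros x Hx; apply B2, Hx. }
destruct (comp_re_gt s 0 ltac:(lra)) as [S1 S2].
revert z; induction m as [|m IH]; intros z Ht H1 H2.
- replace (t - bnat 0)%B with t; [reflexivity|].
  apply bicomplex_ext; bcomp; simpl; ring.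
- rewrite S_INR in Ht.
  destruct (comp_re_gt t (INR m + 1) Ht) as [T1 T2].
  exists (fun x => bpow L1 L2 x (t - bnat m - bnat 1) *
       prabhakar d s (t - bnat m) (l * bpow L1 L2 x s))%B; split.
  (* The induction hypothesis is available only over the domains of the branches, so the
     neighbourhood of [z] must have its components in [U1] and [U2]. *)
  + generalize (locally_comp z _ _ (O1 _ H1) (O2 _ H2)).
    apply filter_imp; intros x [X1 X2]; apply IH; try assumption; lra.
  (* [g] is the closed form of the derivative of order [k] in one component; a single step from [m]
     to [S m] then serves both components. *)
  + set (g := fun (L : C -> C) (d s t l : C) (k : nat) (w : C) =>
      (Cexp ((t - RtoC (INR k) - 1) * L w) *
       Cprabhakar d s (t - RtoC (INR k)) (l * Cexp (s * L w)))%C).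
    assert (D : forall L w d s t l,
      locally (w : C_UniformSpace) (fun x : C => Cexp (L x) = x) -> ex_derive L w ->
      0 < fst s -> INR m + 1 < fst t ->
      is_derive (g L d s t l m) w (g L d s t l (S m) w)).
    { clear; intros L w d s t l HL EL Hs Ht; unfold g.
      replace (t - RtoC (INR (S m)))%C with (t - RtoC (INR m) - 1)%C
        by (rewrite S_INR, RtoC_plus; ring).
      apply is_derive_Cpow_Cprabhakar; [exact HL|exact EL|exact Hs| |reflexivity].
      simpl; lra. }
    apply is_bderive_componentwise with (U1 := U1) (U2 := U2)
      (f1 := g L1 (comp1 d) (comp1 s) (comp1 t) (comp1 l) m)
      (f2 := g L2 (comp2 d) (comp2 s) (comp2 t) (comp2 l) m)
      (g1 := g L1 (comp1 d) (comp1 s) (comp1 t) (comp1 l) (S m))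
      (g2 := g L2 (comp2 d) (comp2 s) (comp2 t) (comp2 l) (S m)); try assumption.
    * intros w Hw; apply D; auto; apply B1, Hw.
    * intros w Hw; apply D; auto; apply B2, Hw.
    * intros x; unfold bpow; bcomp; reflexivity.
    * intros x; unfold bpow; bcomp; reflexivity.
    * unfold bpow; bcomp; reflexivity.
    * unfold bpow; bcomp; reflexivity.
Qed.

Theorem theorem3p2 :
  forall (sigma tau delta zeta : bicomplex) (n : nat),
    Rabs (bIm_j tau) < bRe tau ->
    Rabs (bIm_j sigma) < bRe sigma ->
    (1 <= n)%nat ->
    is_bderive_n n (prabhakar delta sigma tau) zeta
      (bpoch delta n *
         prabhakar (delta + bnat n) sigma (tau + bnat n * sigma) zeta)%B
    /\
    (exists d : bicomplex,
       is_bderive (prabhakar delta sigma tau) zeta d /\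
       (zeta * d + delta * prabhakar delta sigma tau zeta)%B =
       (delta * prabhakar (delta + bnat 1) sigma tau zeta)%B)
    /\
    (forall (lambda : bicomplex) (U1 U2 : C -> Prop) (L1 L2 : C -> C),
       log_branch U1 L1 ->
       log_branch U2 L2 ->
       U1 (comp1 zeta) ->
       U2 (comp2 zeta) ->
       Rabs (bIm_j tau) < bRe tau - INR n ->
       is_bderive_n n
         (fun x : bicomplex =>
            (bpow L1 L2 x (tau - bnat 1) *
               prabhakar delta sigma tau (lambda * bpow L1 L2 x sigma))%B)
         zeta
         (bpow L1 L2 zeta (tau - bnat n - bnat 1) *
            prabhakar delta sigma (tau - bnat n)
              (lambda * bpow L1 L2 zeta sigma))%B).
Proof.
intros sigma tau delta zeta n Ht Hs _; split; [|split].
- apply is_bderive_n_prabhakar; assumption.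
- exists (delta * prabhakar (delta + bnat 1) sigma (tau + sigma) zeta)%B; split.
  (* A factor [bnat 1] brings the function to the scaled form whose derivative is known. *)
  + replace (prabhakar delta sigma tau)
      with (fun x => bnat 1 * prabhakar delta sigma tau x)%B.
    * replace (delta * prabhakar (delta + bnat 1) sigma (tau + sigma) zeta)%B
        with (bnat 1 * (delta * prabhakar (delta + bnat 1) sigma (tau + sigma) zeta))%B.
      -- apply is_bderive_prabhakar_scal; assumption.
      -- apply bicomplex_ext; bcomp; simpl; ring.
    * apply functional_extensionality; intros x.
      apply bicomplex_ext; bcomp; simpl; ring.
  + destruct (comp_re_gt tau 0 ltac:(lra)) as [T1 T2].
    destruct (comp_re_gt sigma 0 ltac:(lra)) as [S1 S2].
    apply bicomplex_ext; bcomp; apply Cprabhakar_euler; assumption.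
- intros; apply is_bderive_n_bpow_prabhakar with (U1 := U1) (U2 := U2); assumption.
Qed.
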